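(* Assume the following two conjectural statements hold. (Poonen) For every integer $N\ge 4$, no quadratic polynomial in $\mathbb{Q}[z]$ has a rational periodic point of exact period $N$. (Manes) If $\phi\in\mathbb{Q}(z)$ is a rational map of degree $2$ with $\mathrm{Aut}(\phi)\cong C_2$, then $\phi$ has no rational periodic point of exact period $N>4$. Then the pairs $f(z)=z^2+c$, $\phi_{k,b}(z)=kz+b/z$, with $c\in\mathbb{Q}$ and $k,b\in\mathbb{Q}^{\times}$, such that some rational number is a periodic point of both maps are exactly the pairs in the following nine families. In each family, periodic points of $\phi_{k,b}$ and of $f$ having the indicated exact period are listed; in families 1--6 the common periodic point is $p$, and in families 7--9 it is $p_\tau$. 1. $\phi_{k,b}(z)=\frac{q+p}{p}z-\frac{qp}{z}$, with periodic points $p,-p$ of exact period $1$; $f(z)=z^2+p-p^2$, with periodic points $p,1-p$ of exact period $1$; here $p\in\mathbb{Q}^\times$, $q\in\mathbb{Q}\setminus\{0,-p\}$. 2. $\phi_{k,b}(z)=\frac{q-p}{p}z-\frac{qp}{z}$, with periodic points $p,-p$ of exact period $2$; $f(z)=z^2+p-p^2$, with periodic points $p,1-p$ of exact period $1$; here $p\in\mathbb{Q}^\times$, $q\in\mathbb{Q}\setminus\{0,p\}$. 3. $\phi_{k,b}(z)=\frac{2q}{q^2-1}z-\frac{p^2(q^2+1)}{q(q^2-1)z}$, with periodic points $p,\ p/q,\ -p,\ -p/q$ of exact period $4$; $f(z)=z^2+p-p^2$, with periodic points $p,1-p$ of exact period $1$; here $p\in\mathbb{Q}^\times$, $q\in\mathbb{Q}\setminus\{0,\pm1\}$.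 4. $\phi_{k,b}(z)=\frac{q+p}{p}z-\frac{qp}{z}$, with periodic points $p,-p$ of exact period $1$; $f(z)=z^2-(p^2+p+1)$, with periodic points $p,-p-1$ of exact period $2$; here $p\in\mathbb{Q}\setminus\{0,-1/2\}$, $q\in\mathbb{Q}\setminus\{0,-p\}$. 5. $\phi_{k,b}(z)=\frac{q-p}{p}z-\frac{qp}{z}$, with periodic points $p,-p$ of exact period $2$; $f(z)=z^2-(p^2+p+1)$, with periodic points $p,-p-1$ of exact period $2$; here $p\in\mathbb{Q}\setminus\{0,-1/2\}$, $q\in\mathbb{Q}\setminus\{0,p\}$. 6. $\phi_{k,b}(z)=\frac{2q}{q^2-1}z-\frac{p^2(q^2+1)}{q(q^2-1)z}$, with periodic points $p,\ p/q,\ -p,\ -p/q$ of exact period $4$; $f(z)=z^2-(p^2+p+1)$, with periodic points $p,-p-1$ of exact period $2$; here $p\in\mathbb{Q}\setminus\{0,-1/2\}$, $q\in\mathbb{Q}\setminus\{0,\pm1\}$. 7. $\phi_{k,b}(z)=\frac{q+p_\tau}{p_\tau}z-\frac{qp_\tau}{z}$, with periodic points $p_\tau,-p_\tau$ of exact period $1$; $f(z)=z^2+c_\tau$, with periodic points $p_\tau,p'_\tau,p''_\tau$ of exact period $3$; here $\tau\in\mathbb{Q}\setminus\{-1,0\}$, $q\in\mathbb{Q}\setminus\{0,-p_\tau\}$. 8. $\phi_{k,b}(z)=\frac{q-p_\tau}{p_\tau}z-\frac{qp_\tau}{z}$, with periodic points $p_\tau,-p_\tau$ of exact period $2$; $f(z)=z^2+c_\tau$,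 with periodic points $p_\tau,p'_\tau,p''_\tau$ of exact period $3$; here $\tau\in\mathbb{Q}\setminus\{-1,0\}$, $q\in\mathbb{Q}\setminus\{0,p_\tau\}$. 9. $\phi_{k,b}(z)=\frac{2q}{q^2-1}z-\frac{p_\tau^2(q^2+1)}{q(q^2-1)z}$, with periodic points $p_\tau,\ p_\tau/q,\ -p_\tau,\ -p_\tau/q$ of exact period $4$; $f(z)=z^2+c_\tau$, with periodic points $p_\tau,p'_\tau,p''_\tau$ of exact period $3$; here $\tau\in\mathbb{Q}\setminus\{-1,0\}$, $q\in\mathbb{Q}\setminus\{0,\pm1\}$. Here $$c_\tau=-\frac{\tau^6+2\tau^5+4\tau^4+8\tau^3+9\tau^2+4\tau+1}{4\tau^2(\tau+1)^2},\quad p_\tau=\frac{\tau^3+2\tau^2+\tau+1}{2\tau(\tau+1)},\quad p'_\tau=\frac{\tau^3-\tau-1}{2\tau(\tau+1)},\quad p''_\tau=-\frac{\tau^3+2\tau^2+3\tau+1}{2\tau(\tau+1)}.$$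
   Context: A rational map is regarded as a self-map of $\mathbb{P}^1$; in particular $\phi_{k,b}(0)=\infty$ and $\phi_{k,b}(\infty)=\infty$. Periodic points are understood to be finite. A point $P$ is periodic for $\phi$ if $\phi^n(P)=P$ for some $n>0$, where $\phi^n$ is the $n$-fold iterate; the smallest such $n$ is the exact period of $P$. For a rational map $\phi$ over $\mathbb{Q}$, $\mathrm{Aut}(\phi)=\{f\in\mathrm{PGL}_2(\overline{\mathbb{Q}}): f^{-1}\circ\phi\circ f=\phi\}$, and $C_2$ is the cyclic group of order $2$. *)

(* Defs.v *)
From HB Require Import structures.
From mathcomp Require Import all_boot all_order all_algebra all_field.

Set Implicit Arguments.
Unset Strict Implicit.
Unset Printing Implicit Defensive.

Import Order.TTheory GRing.Theory Num.Theory.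
Local Open Scope ring_scope.
Local Open Scope quotient_scope.

Section Dynamics.
Variables (T : Type) (f : T -> T).

Definition periodic (x : T) : Prop :=
  exists n : nat, (0 < n)%N /\ iter n f x = x.

Definition exact_period (n : nat) (x : T) : Prop :=
  [/\ (0 < n)%N, iter n f x = x &
      forall m : nat, (0 < m < n)%N -> iter m f x <> x].

End Dynamics.

Section ProjectiveLine.
Variable F : fieldType.

(* [Some z] is the finite point z and [None] is the point at infinity. *)
Definition P1 : Type := option F.

(* The self-map of P^1 given by n / d, for coprime n and d.  At infinity it is *)
(* the ratio of the coefficients of degree max (deg n) (deg d).                *)
Definition P1_eval (n d : {poly F}) (P : P1) : P1 :=
  match P with
  | Some z => if d.[z] == 0 then None else Some (n.[z] / d.[z])
  | None => let m := (maxn (size n) (size d)).-1 in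
            if d`_m == 0 then None else Some (n`_m / d`_m)
  end.

End ProjectiveLine.

Section RationalFunctions.
Variable F : fieldType.
Implicit Type phi : {fraction {poly F}}.

(* Representatives in [{fraction _}] need not be in lowest terms. *)
Definition rnum phi : {poly F} :=
  \n_(repr phi) %/ gcdp \n_(repr phi) \d_(repr phi).
Definition rden phi : {poly F} :=
  \d_(repr phi) %/ gcdp \n_(repr phi) \d_(repr phi).

Definition rat_degree phi : nat := (maxn (size (rnum phi)) (size (rden phi))).-1.

Definition rat_map phi : P1 F -> P1 F := P1_eval (rnum phi) (rden phi).

End RationalFunctions.

(* Base change to an algebraic closure of Q ([algC]); coprimality is preserved. *)
Definition rat_map_algC (phi : {fraction {poly rat}}) : P1 algC -> P1 algC :=
  P1_eval (map_poly ratr (rnum phi)) (map_poly ratr (rden phi)).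

Section PGL2.
Variable F : fieldType.

Record GL2 := MkGL2 { GL2_val :> 'M[F]_2; GL2_unit : GL2_val \in unitmx }.
HB.instance Definition _ := [isSub for GL2_val].
HB.instance Definition _ := [Choice of GL2 by <:].

Definition GL2_one : GL2 := MkGL2 (unitmx1 F 2).
Definition GL2_mul (M N : GL2) : GL2 :=
  @MkGL2 (M *m N) (etrans (unitmx_mul M N)
                          (introT andP (conj (GL2_unit M) (GL2_unit N)))).
Definition GL2_inv (M : GL2) : GL2 :=
  @MkGL2 (invmx M) (etrans (unitmx_inv M) (GL2_unit M)).

Definition GL2_prop (M N : GL2) : bool := is_scalar_mx (M *m invmx N).

Lemma GL2_propP (M N : GL2) :
  reflect (exists a : F, (M : 'M_2) = a *: (N : 'M_2)) (GL2_prop M N).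
Proof.
apply: (iffP is_scalar_mxP) => -[a E]; exists a.
  by rewrite -mul_scalar_mx -E mulmxKV ?GL2_unit.
by rewrite E -scalemxAl mulmxV ?GL2_unit // scalemx1.
Qed.

Lemma GL2_scale_neq0 (M N : GL2) a : (M : 'M_2) = a *: (N : 'M_2) -> a != 0.
Proof.
move=> E; apply/eqP => a0; move: (GL2_unit M).
by rewrite E a0 scale0r unitmxE det0 unitr0.
Qed.

Lemma GL2_prop_refl : reflexive GL2_prop.
Proof. by move=> M; apply/GL2_propP; exists 1; rewrite scale1r. Qed.

Lemma GL2_prop_sym : symmetric GL2_prop.
Proof.
have imp M N : GL2_prop M N -> GL2_prop N M.
  case/GL2_propP=> a E; apply/GL2_propP; exists a^-1.
  by rewrite E scalerA mulVf ?scale1r // (GL2_scale_neq0 E).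
by move=> M N; apply/idP/idP; apply: imp.
Qed.

Lemma GL2_prop_trans : transitive GL2_prop.
Proof.
move=> N M P /GL2_propP[a E] /GL2_propP[b E'].
by apply/GL2_propP; exists (a * b); rewrite E E' scalerA.
Qed.

Canonical GL2_prop_equiv :=
  EquivRel GL2_prop GL2_prop_refl GL2_prop_sym GL2_prop_trans.

Definition PGL2 := {eq_quot GL2_prop}.
HB.instance Definition _ : EqQuotient _ GL2_prop PGL2 := EqQuotient.on PGL2.
HB.instance Definition _ := Choice.on PGL2.

Definition PGL2_one : PGL2 := \pi_PGL2 GL2_one.
Definition PGL2_mul (g h : PGL2) : PGL2 := \pi_PGL2 (GL2_mul (repr g) (repr h)).
Definition PGL2_inv (g : PGL2) : PGL2 := \pi_PGL2 (GL2_inv (repr g)).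

Lemma PGL2_eq (M N : GL2) :
  (exists a : F, (M : 'M_2) = a *: (N : 'M_2)) -> \pi_PGL2 M = \pi_PGL2 N.
Proof. by move=> E; apply/eqP; rewrite eqmodE; apply/GL2_propP. Qed.

Lemma PGL2_reprE (M : GL2) :
  exists a : F, (repr (\pi_PGL2 M) : 'M_2) = a *: (M : 'M_2).
Proof. by apply/GL2_propP; rewrite -[GL2_prop _ _]eqmodE; rewrite reprK. Qed.

Lemma PGL2_mulA : associative PGL2_mul.
Proof.
move=> x y z; apply: PGL2_eq => /=.
have [a ->] := PGL2_reprE (GL2_mul (repr y) (repr z)).
have [b Eb] := PGL2_reprE (GL2_mul (repr x) (repr y)).
have b0 := GL2_scale_neq0 Eb; exists (a / b).
by rewrite Eb /= -scalemxAr -scalemxAl mulmxA scalerA divfK.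
Qed.

Lemma PGL2_mul1 : left_id PGL2_one PGL2_mul.
Proof.
move=> x; rewrite -[RHS]reprK; apply: PGL2_eq => /=.
have [a ->] := PGL2_reprE GL2_one.
by exists a; rewrite /= -scalemxAl mul1mx.
Qed.

Lemma PGL2_mulr1 : right_id PGL2_one PGL2_mul.
Proof.
move=> x; rewrite -[RHS]reprK; apply: PGL2_eq => /=.
have [a ->] := PGL2_reprE GL2_one.
by exists a; rewrite /= -scalemxAr mulmx1.
Qed.

Lemma PGL2_mulV : left_inverse PGL2_one PGL2_inv PGL2_mul.
Proof.
move=> x; apply: PGL2_eq => /=.
have [a ->] := PGL2_reprE (GL2_inv (repr x)).
by exists a; rewrite /= -scalemxAl mulVmx ?GL2_unit.
Qed.

Lemma PGL2_mulrV : right_inverse PGL2_one PGL2_inv PGL2_mul.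
Proof.
move=> x; apply: PGL2_eq => /=.
have [a ->] := PGL2_reprE (GL2_inv (repr x)).
by exists a; rewrite /= -scalemxAr mulmxV ?GL2_unit.
Qed.

HB.instance Definition _ :=
  isGroup.Build PGL2 PGL2_mulA PGL2_mul1 PGL2_mulr1 PGL2_mulV PGL2_mulrV.

Definition mobius (M : 'M[F]_2) : P1 F -> P1 F :=
  fun P => match P with
  | Some z => if M 1 0 * z + M 1 1 == 0 then None
              else Some ((M 0 0 * z + M 0 1) / (M 1 0 * z + M 1 1))
  | None => if M 1 0 == 0 then None else Some (M 0 0 / M 1 0)
  end.

Definition PGL2_act (g : PGL2) : P1 F -> P1 F := mobius (repr g).

(* The action does not depend on the representative. *)
Lemma PGL2_actE (M : GL2) : PGL2_act (\pi_PGL2 M) =1 mobius M.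
Proof.
have [a E] := PGL2_reprE M; have a0 := GL2_scale_neq0 E.
have div_a u v : (a * u) / (a * v) = u / v.
  have [->|v0] := eqVneq v 0; first by rewrite mulr0 invr0 !mulr0.
  by rewrite invfM mulrACA mulfV // mul1r.
case=> [z|]; rewrite /PGL2_act /mobius E !mxE.
  by rewrite -!mulrA -!mulrDr mulf_eq0 (negPf a0) /= div_a.
by rewrite mulf_eq0 (negPf a0) /= div_a.
Qed.

End PGL2.

(* Rational functions over an infinite field are equal iff they induce the     *)
(* same self-map of P^1, so g^-1 o phi o g = phi is stated pointwise.          *)
Definition Aut (phi : {fraction {poly rat}}) (g : PGL2 algC) : Prop :=
  forall P : P1 algC,
    PGL2_act g^-1%g (rat_map_algC phi (PGL2_act g P)) = rat_map_algC phi P.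

(* The group law of ['Z_2] is addition mod 2; h is an isomorphism onto the     *)
(* subset A of G, which is then a subgroup of G.                               *)
Definition isog_C2 (G : groupType) (A : G -> Prop) : Prop :=
  exists h : 'Z_2 -> G,
    [/\ {morph h : x y / (x * y)%g},
        injective h &
        forall g, A g <-> exists x, h x = g].

Definition poonen_conjecture : Prop :=
  forall N : nat, (4 <= N)%N ->
  forall f : {poly rat}, size f = 3%N ->
  ~ exists x : rat, exact_period (horner f) N x.

Definition manes_conjecture : Prop :=
  forall phi : {fraction {poly rat}},
  rat_degree phi = 2%N -> isog_C2 (Aut phi) ->
  forall N : nat, (4 < N)%N ->
  ~ exists x : rat, exact_period (rat_map phi) N (Some x).

Local Notation "p %:F" := (@FracField.tofrac _ p).

Definition phi_ (k b : rat) : {fraction {poly rat}} :=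
  (k%:P)%:F * 'X%:F + (b%:P)%:F / 'X%:F.

Definition quad (c : rat) : {poly rat} := 'X^2 + c%:P.

Definition c_ (t : rat) : rat :=
  - ((t ^+ 6 + 2 * t ^+ 5 + 4 * t ^+ 4 + 8 * t ^+ 3 + 9 * t ^+ 2 + 4 * t + 1)
     / (4 * t ^+ 2 * (t + 1) ^+ 2)).
Definition p_ (t : rat) : rat :=
  (t ^+ 3 + 2 * t ^+ 2 + t + 1) / (2 * t * (t + 1)).
Definition p'_ (t : rat) : rat := (t ^+ 3 - t - 1) / (2 * t * (t + 1)).
Definition p''_ (t : rat) : rat :=
  - ((t ^+ 3 + 2 * t ^+ 2 + 3 * t + 1) / (2 * t * (t + 1))).

(* A member of a family: the coefficients of phi_{k,b}, the listed periodic   *)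
(* points of phi_{k,b} with their exact period, the coefficient of z^2 + c,   *)
(* the listed periodic points of z^2 + c with their exact period, and the     *)
(* common periodic point.                                                     *)
Record member := Member {
  mem_k : rat; mem_b : rat; phi_points : seq rat; phi_period : nat;
  mem_c : rat; f_points : seq rat; f_period : nat;
  common_point : rat }.

Inductive common_family : nat -> member -> Prop :=
| family1 (p q : rat) of p != 0 & q \notin [:: 0; - p] :
    common_family 1 (Member ((q + p) / p) (- (q * p)) [:: p; - p] 1
                     (p - p ^+ 2) [:: p; 1 - p] 1 p)
| family2 (p q : rat) of p != 0 & q \notin [:: 0; p] :
    common_family 2 (Member ((q - p) / p) (- (q * p)) [:: p; - p] 2
                     (p - p ^+ 2) [:: p; 1 - p] 1 p)
| family3 (p q : rat) of p != 0 & q \notin [:: 0; 1; -1] :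
    common_family 3 (Member (2 * q / (q ^+ 2 - 1))
                     (- (p ^+ 2 * (q ^+ 2 + 1) / (q * (q ^+ 2 - 1))))
                     [:: p; p / q; - p; - (p / q)] 4
                     (p - p ^+ 2) [:: p; 1 - p] 1 p)
| family4 (p q : rat) of p \notin [:: 0; - (1 / 2)] & q \notin [:: 0; - p] :
    common_family 4 (Member ((q + p) / p) (- (q * p)) [:: p; - p] 1
                     (- (p ^+ 2 + p + 1)) [:: p; - p - 1] 2 p)
| family5 (p q : rat) of p \notin [:: 0; - (1 / 2)] & q \notin [:: 0; p] :
    common_family 5 (Member ((q - p) / p) (- (q * p)) [:: p; - p] 2
                     (- (p ^+ 2 + p + 1)) [:: p; - p - 1] 2 p)
| family6 (p q : rat) of p \notin [:: 0; - (1 / 2)] & q \notin [:: 0; 1; -1] :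
    common_family 6 (Member (2 * q / (q ^+ 2 - 1))
                     (- (p ^+ 2 * (q ^+ 2 + 1) / (q * (q ^+ 2 - 1))))
                     [:: p; p / q; - p; - (p / q)] 4
                     (- (p ^+ 2 + p + 1)) [:: p; - p - 1] 2 p)
| family7 (t q : rat) of t \notin [:: -1; 0] & q \notin [:: 0; - p_ t] :
    common_family 7 (Member ((q + p_ t) / p_ t) (- (q * p_ t)) [:: p_ t; - p_ t] 1
                     (c_ t) [:: p_ t; p'_ t; p''_ t] 3 (p_ t))
| family8 (t q : rat) of t \notin [:: -1; 0] & q \notin [:: 0; p_ t] :
    common_family 8 (Member ((q - p_ t) / p_ t) (- (q * p_ t)) [:: p_ t; - p_ t] 2
                     (c_ t) [:: p_ t; p'_ t; p''_ t] 3 (p_ t))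
| family9 (t q : rat) of t \notin [:: -1; 0] & q \notin [:: 0; 1; -1] :
    common_family 9 (Member (2 * q / (q ^+ 2 - 1))
                     (- (p_ t ^+ 2 * (q ^+ 2 + 1) / (q * (q ^+ 2 - 1))))
                     [:: p_ t; p_ t / q; - p_ t; - (p_ t / q)] 4
                     (c_ t) [:: p_ t; p'_ t; p''_ t] 3 (p_ t)).

(* Main.v *)
(* A common periodic point x is a cycle of length at most 3 of z^2 + c, by     *)
(* Poonen, and of length at most 4 of phi = kz + b/z, by Manes.  The latter    *)
(* needs Aut phi = C_2, which fails exactly for k = -1/2; there phi is a twist *)
(* of z^-2 and reduces to t^2 - 2 on Q, so no cycle is longer than 2.          *)
(* A 3-cycle of the odd map phi would give a 6-cycle of -phi, which Manes also *)
(* excludes, and a 4-cycle not stable under z -> -z would give a nontrivial    *)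
(* rational solution of X^2 + Y^2 = U^2, X^2 - Y^2 = V^2, against Fermat.      *)
(* The remaining cycle equations are solved explicitly; the parameter of a     *)
(* 3-cycle x -> y -> w of z^2 + c is tau = x + y.                              *)
Require Import Defs.
From mathcomp Require Import all_boot all_order all_algebra all_field.
From mathcomp Require Import ring lra zify.
Import Order.TTheory GRing.Theory Num.Theory.
Local Open Scope ring_scope.
Local Open Scope quotient_scope.

Set Implicit Arguments.
Unset Strict Implicit.

(** * Rational maps and automorphisms *)

(** Each of the two conjectures bounds the period on one side. For z^2 + c and for phi = kz + b/z
    alike, every surviving period gives a formula for the coefficients in terms of x and one
    parameter, or of one parameter that also determines x. Crossing the three quadratic cases
    ([quad_periodic]) with the three cases for phi ([kzbz_periodic]) yields the nine families.

    On the quadratic side the cases are c = x - x^2, a 2-cycle with sum -1, and a parametrized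
    3-cycle. On the side of phi they are the fixed point equation b = (1 - k)x^2, the 2-cycle x, -x,
    and the 4-cycle x, y, -x, -y with q = x/y.

    Manes applies once Aut(phi) is known: for k other than -1/2, a Moebius map commuting with phi is
    z or -z ([mobius_commutant], [Aut_phi_C2]). The value k = -1/2 is settled unconditionally by
    [periodic_kzbz_half]. Length 3 is excluded by [kzbz_no_exact3], and the shape of a 4-cycle comes
    from [cycle4_symmetric], which rests on the infinite descent in [no_sum_diff_sqr]. The converse,
    [family_periodic], is a direct verification. *)

Lemma rnum_rdenP (F : fieldType) (phi : {fraction {poly F}}) (n d : {poly F}) :
  d != 0 -> coprimep n d ->
  phi = FracField.tofrac n / FracField.tofrac d ->
  exists2 a : F, a != 0 & rnum phi = a *: n /\ rden phi = a *: d.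
Proof.
move=> d0 cop ->; set phi0 := (_ / _).
have phiE : phi0 = \pi_({fraction {poly F}}) (Ratio n d).
  rewrite /phi0 !piE /FracField.invf /FracField.mulf.
  by rewrite !numden_Ratio ?oner_eq0 // mulr1 mul1r.
have cross : rnum phi0 * d = rden phi0 * n.
  have := FracField.equivf_l (Ratio n d).
  rewrite -phiE !numden_Ratio // => E.
  have g0 : gcdp \n_(repr phi0) \d_(repr phi0) != 0.
    by rewrite gcdp_eq0 negb_and denom_ratioP orbT.
  apply: (mulIf g0).
  by rewrite mulrAC divpK ?dvdp_gcdl // E mulrAC divpK ?dvdp_gcdr.
have cop' : coprimep (rnum phi0) (rden phi0).
  by apply: coprimep_div_gcd; rewrite denom_ratioP orbT.
(* Both pairs are coprime, so cross-multiplication makes the two denominators divide each other. *)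
have : rden phi0 %= d.
  have cop'_sym : coprimep (rden phi0) (rnum phi0) by rewrite coprimep_sym.
  have cop_sym : coprimep d n by rewrite coprimep_sym.
  rewrite /eqp -(Gauss_dvdpr d cop'_sym) cross dvdp_mulr //=.
  by rewrite -(Gauss_dvdpl _ cop_sym) -cross dvdp_mull.
case/eqpf_eq=> a a0 E; exists a => //; split => //.
by apply: (mulIf d0); rewrite cross E -!scalerAl mulrC.
Qed.

Section Kz_plus_b_over_z.
Variable F : fieldType.
Implicit Types k b z : F.

Definition kzbz k b (P : P1 F) : P1 F :=
  if P is Some z then (if z == 0 then None else Some (k * z + b / z)) else None.

Lemma kzbz_some k b z : z != 0 -> kzbz k b (Some z) = Some (k * z + b / z).
Proof. by move=> z0; rewrite /kzbz (negPf z0). Qed.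

Lemma size_kX2b k b : k != 0 -> size (k *: 'X^2 + b%:P) = 3%N.
Proof.
move=> k0; rewrite size_polyDl size_scale ?size_polyXn //.
by rewrite (leq_ltn_trans (size_polyC_leq1 _)).
Qed.

Lemma P1_eval_kzbz k b a :
  k != 0 -> a != 0 -> P1_eval (a *: (k *: 'X^2 + b%:P)) (a *: 'X) =1 kzbz k b.
Proof.
move=> k0 a0 [z|] /=; last first.
  by rewrite !size_scale // size_kX2b // size_polyX /= !coefZ coefX /= mulr0 eqxx.
rewrite !hornerE mulf_eq0 (negPf a0) /=; case: eqVneq => // z0.
by congr Some; field; rewrite z0.
Qed.

End Kz_plus_b_over_z.

Section Phi.
Variables k b : rat.
Hypotheses (k0 : k != 0) (b0 : b != 0).

Lemma rnum_rden_phi :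
  exists2 a : rat, a != 0 &
    rnum (phi_ k b) = a *: (k *: 'X^2 + b%:P) /\ rden (phi_ k b) = a *: 'X.
Proof.
apply: rnum_rdenP; first by rewrite polyX_eq0.
  by rewrite coprimepX rootE !hornerE /= mulr0 add0r.
have X0 : FracField.tofrac ('X : {poly rat}) != 0 by rewrite tofrac_eq0 polyX_eq0.
rewrite /phi_ -mul_polyC tofracD tofracM tofracXn.
by rewrite mulrDl expr2 mulrA mulfK.
Qed.

Lemma rat_degree_phi : rat_degree (phi_ k b) = 2%N.
Proof.
have [a a0 [nE dE]] := rnum_rden_phi.
by rewrite /rat_degree nE dE !size_scale // size_kX2b // size_polyX.
Qed.

Lemma rat_map_phi : rat_map (phi_ k b) =1 kzbz k b.
Proof.
have [a a0 [nE dE]] := rnum_rden_phi => P.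
by rewrite /rat_map nE dE P1_eval_kzbz.
Qed.

Lemma rat_map_algC_phi : rat_map_algC (phi_ k b) =1 kzbz (ratr k) (ratr b).
Proof.
have [a a0 [nE dE]] := rnum_rden_phi => P.
rewrite /rat_map_algC nE dE !map_polyZ rmorphD /= map_polyZ map_polyXn map_polyX.
by rewrite map_polyC P1_eval_kzbz ?fmorph_eq0.
Qed.

End Phi.

(** * Moebius maps and the automorphism group of kz + b/z *)

Section Mobius.
Variable F : fieldType.
Implicit Types (M N : 'M[F]_2) (g : PGL2 F) (P : P1 F).

Lemma mulmx22E M N i j : (M *m N) i j = M i 0 * N 0 j + M i 1 * N 1 j.
Proof.
rewrite mxE !big_ord_recl big_ord0 addr0.
by congr (M _ _ * N _ _ + M _ _ * N _ _); apply: val_inj.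
Qed.

Lemma unitmx22E M : (M \in unitmx) = (M 0 0 * M 1 1 != M 0 1 * M 1 0).
Proof.
rewrite unitmxE unitfE -[M 0 0 * _ == _]subr_eq0; congr (_ != _).
rewrite (expand_det_row M 0) !big_ord_recl big_ord0 addr0 /cofactor !det_mx11 !mxE /=.
rewrite expr0 mul1r expr1 mulN1r mulrN.
by congr (M _ _ * M _ _ - M _ _ * M _ _); apply: val_inj.
Qed.

(** The cases are whether [N], and then [M], sends its argument to infinity. Invertibility of [N]
    keeps the numerator and denominator of its value from vanishing together. *)
Lemma mobiusM M N P : N \in unitmx -> mobius (M *m N) P = mobius M (mobius N P).
Proof.
rewrite unitmx22E => detN.
case: P => [z|] /=; rewrite !mulmx22E; last first.
  have [c0|c0] := eqVneq (N 1 0) 0.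
    have a0 : N 0 0 != 0.
      by apply: contraNneq detN => ->; rewrite c0 mul0r mulr0.
    rewrite c0 !mulr0 !addr0 mulf_eq0 (negPf a0) orbF /=.
    by case: eqVneq => // c'0; congr Some; rewrite -mulf_div divff ?mulr1.
  rewrite /= (_ : M 1 0 * (N 0 0 / N 1 0) + M 1 1
      = (M 1 0 * N 0 0 + M 1 1 * N 1 0) / N 1 0); last by field.
  rewrite mulf_eq0 invr_eq0 (negPf c0) orbF.
  by case: eqVneq => // d0; congr Some; field; rewrite d0 c0.
set u := N 0 0 * z + N 0 1; set v := N 1 0 * z + N 1 1.
have -> : (M 1 0 * N 0 0 + M 1 1 * N 1 0) * z + (M 1 0 * N 0 1 + M 1 1 * N 1 1)
    = M 1 0 * u + M 1 1 * v by rewrite /u /v; ring.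
have -> : (M 0 0 * N 0 0 + M 0 1 * N 1 0) * z + (M 0 0 * N 0 1 + M 0 1 * N 1 1)
    = M 0 0 * u + M 0 1 * v by rewrite /u /v; ring.
have [v0|v0] := eqVneq v 0.
  have u0 : u != 0.
    apply: contraNneq detN => u0; apply/eqP.
    have -> : N 0 0 * N 1 1 = N 0 0 * v - N 1 0 * u + N 0 1 * N 1 0.
      by rewrite /u /v; ring.
    by rewrite u0 v0 !mulr0 subrr add0r.
  rewrite v0 !mulr0 !addr0 mulf_eq0 (negPf u0) orbF /=.
  by case: eqVneq => // c'0; congr Some; rewrite -mulf_div divff ?mulr1.
rewrite /= (_ : M 1 0 * (u / v) + M 1 1 = (M 1 0 * u + M 1 1 * v) / v); last by field.
rewrite mulf_eq0 invr_eq0 (negPf v0) orbF.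
by case: eqVneq => // d0; congr Some; field; rewrite d0 v0.
Qed.

Lemma mobius1 P : mobius 1%:M P = P.
Proof.
case: P => [z|]; rewrite /mobius !mxE /= ?eqxx // mul0r add0r oner_eq0.
by rewrite divr1 mul1r addr0.
Qed.

Lemma PGL2_actK g : cancel (PGL2_act g) (PGL2_act g^-1%g).
Proof.
move=> P; rewrite /PGL2_act -/(PGL2_act _) PGL2_actE -mobiusM ?GL2_unit //=.
by rewrite mulVmx ?GL2_unit // mobius1.
Qed.

Lemma PGL2_actVK g : cancel (PGL2_act g^-1%g) (PGL2_act g).
Proof. by move=> P; rewrite -{1}[g]invgK PGL2_actK. Qed.

End Mobius.

Section KzbzCommutant.
Variable F : numFieldType.
Variables k b : F.
Hypotheses (k0 : k != 0) (b0 : b != 0) (kN : 2 * k + 1 != 0).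

(* M sends infinity to a fixed point p of kz + b/z.  If p is finite, then the  *)
(* pole m of M and its image under M are compared with the fixed points, which *)
(* forces 4 k^2 = 1; k = 1/2 would make M singular.                            *)
Lemma mobius_commutant (M : 'M[F]_2) : M \in unitmx ->
  (forall P, kzbz k b (mobius M P) = mobius M (kzbz k b P)) ->
  [/\ M 0 1 = 0, M 1 0 = 0 & M 0 0 = M 1 1 \/ M 0 0 = - M 1 1].
Proof.
rewrite unitmx22E; set a := M 0 0; set e := M 0 1; set c := M 1 0; set d := M 1 1.
move=> det comm.
have := comm None; have := comm (Some 0); rewrite /mobius /= -/a -/e -/c -/d eqxx.
rewrite !mulr0 !add0r.
(* If [M] fixes infinity, commuting at 0 forces M(0) = 0, so [M] is z -> (a/d)z; commuting at 1 then
   gives a^2 = d^2. *)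
have [c0|c0] := eqVneq c 0.
  rewrite c0 mulr0 in det.
  have /norP[a0 d0] : ~~ ((a == 0) || (d == 0)) by rewrite -mulf_eq0.
  rewrite (negPf d0) /= mulf_eq0 invr_eq0 (negPf d0) orbF.
  case: eqVneq => // e0 _ _; split=> //.
  have := comm (Some 1); rewrite /mobius /= -/a -/e -/c -/d c0 e0 !mul0r !add0r !addr0.
  rewrite (negPf d0) oner_eq0 /= !(mul0r, add0r, addr0) (negPf d0) mulr1 mulf_eq0
    invr_eq0.
  rewrite (negPf d0) (negPf a0) /= divr1 ?mulr1 => -[E].
  have : a ^+ 2 == d ^+ 2.
    have : b * (a ^+ 2 - d ^+ 2)
      = a * d * (a * (k + b) / d - (k * (a / d) + b / (a / d))).
      by field; rewrite a0 d0.
    by rewrite -E subrr mulr0 => /eqP; rewrite mulf_eq0 (negPf b0) subr_eq0.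
  by rewrite eqf_sqr => /orP[/eqP|/eqP]; [left|right].
case: (eqVneq d 0) => [//|d0] /=.
rewrite mulf_eq0 invr_eq0 (negPf d0) orbF; case: (eqVneq e 0) => [//|e0] E0.
rewrite mulf_eq0 invr_eq0 (negPf c0) orbF; case: (eqVneq a 0) => [//|a0] Einf.
case: E0 => E0; case: Einf => Einf.
have pfix : (1 - k) * a ^+ 2 = b * c ^+ 2.
  have -> : (1 - k) * a ^+ 2 = b * c ^+ 2 + a * c * (a / c - (k * (a / c) + b / (a / c))).
    by field; rewrite a0 c0.
  by rewrite Einf subrr mulr0 addr0.
have E0' : c * (k * e ^+ 2 + b * d ^+ 2) = a * e * d.
  have -> : a * e * d = c * d * e * (a / c) by field.
  by rewrite -E0; field; rewrite d0 e0.
(* The preimages of the fixed point p = a/c are p and (1 - k)p/k. Since [M] is invertible, e/d =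
   M(0) differs from p, so it is the second one. *)
have kec : k * (e * c) = (1 - k) * (a * d).
  apply/eqP; rewrite -subr_eq0; apply/eqP.
  have : (e * c - a * d) * (k * (e * c) - (1 - k) * (a * d))
     = c * (c * (k * e ^+ 2 + b * d ^+ 2) - a * e * d)
       + d ^+ 2 * ((1 - k) * a ^+ 2 - b * c ^+ 2) by ring.
  rewrite E0' pfix !subrr !mulr0 addr0 => /eqP; rewrite mulf_eq0 subr_eq0.
  by rewrite eq_sym (negPf det) /= => /eqP.
have k1 : 1 - k != 0.
  have : b * c ^+ 2 != 0 by rewrite mulf_neq0 ?expf_neq0.
  by rewrite -pfix mulf_eq0 negb_or => /andP[].
have m0 : d / c != 0 by rewrite mulf_neq0 ?invr_eq0.
(* [M] sends its pole m = -d/c to the fixed point infinity, so phi(m) is again the pole: m is fixed,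
   and so is d/c by oddness. *)
have mfix : (1 - k) * d ^+ 2 = b * c ^+ 2.
  have := comm (Some (- (d / c))); rewrite /mobius -/a -/e -/c -/d.
  have -> : c * - (d / c) + d = 0 by field.
  rewrite eqxx /= oppr_eq0 (negPf m0) -/c -/d.
  case: eqVneq => // pole _.
  have -> : b * c ^+ 2 = (1 - k) * d ^+ 2 -
      d * (c * (k * - (d / c) + b / - (d / c)) + d) by field; rewrite ?oppr_eq0 d0 c0.
  by rewrite pole mulr0 subr0.
have bE : b = (1 - k) * (d / c) ^+ 2 by rewrite expr_div_n mulrA mfix mulfK ?expf_neq0.
have fixed : k * (d / c) + b / (d / c) = d / c by rewrite bE; field; rewrite d0 c0.
have := comm (Some (d / c)); rewrite kzbz_some // fixed /mobius -/a -/e -/c -/d.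
have -> : c * (d / c) + d = 2 * d by field.
rewrite mulf_eq0 pnatr_eq0 (negPf d0) /=; set y := _ / _.
case: (eqVneq y 0) => // y0 [Ey].
have ysq : y ^+ 2 = (d / c) ^+ 2.
  apply: (mulfI k1); rewrite -bE.
  have -> : (1 - k) * y ^+ 2 = b + y * (y - (k * y + b / y)) by field.
  by rewrite Ey subrr mulr0 addr0.
have ad : a ^+ 2 = d ^+ 2 by apply: (mulfI k1); rewrite pfix mfix.
have ky : k * y = a / (2 * c).
  have -> : k * y = (k * (a * d) + k * (e * c)) / (2 * d * c)
    by rewrite /y; field; rewrite d0 c0.
  by rewrite kec; field; rewrite d0 c0.
(* By [ky], (ky)^2 = p^2/4 with p = a/c, while y^2 = (d/c)^2 = p^2. *)
have : (2 * k + 1) * (2 * k - 1) == 0.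
  have ac0 : (a / c) ^+ 2 != 0 by rewrite expf_neq0 ?mulf_neq0 ?invr_eq0.
  rewrite -(mulIr_eq0 _ (mulIf ac0)).
  have -> : (2 * k + 1) * (2 * k - 1) * (a / c) ^+ 2 =
     4 * k ^+ 2 * (d / c) ^+ 2 - (a / c) ^+ 2 by rewrite !expr_div_n -ad; field.
  rewrite -ysq -mulrA -exprMn ky; apply/eqP; field.
  by rewrite c0.
rewrite mulf_eq0 (negPf kN) subr_eq0 => /eqP k2.
have k2' : 1 - k = k by rewrite -k2; ring.
by move: det kec; rewrite k2' => det /(mulfI k0) E; rewrite E eqxx in det.
Qed.

Lemma kzbzN P : kzbz k b (omap -%R P) = omap -%R (kzbz k b P).
Proof.
case: P => [z|] //=; rewrite oppr_eq0; case: eqVneq => //= z0.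
by congr Some; field.
Qed.

End KzbzCommutant.

Section NegPGL2.
Variable F : numFieldType.

Definition diagN1 : 'M[F]_2 := \matrix_(i, j) ((i == j)%:R * (-1) ^+ (i == 0)).

Lemma diagN1_unit : diagN1 \in unitmx.
Proof. by rewrite unitmx22E !mxE /= expr1 !mul1r mulr1 !mul0r oppr_eq0 oner_eq0. Qed.

Lemma diagN1K : diagN1 *m diagN1 = 1%:M.
Proof.
apply/matrixP => i j; rewrite mulmx22E !mxE.
case: i j => -[|[|//]] ? [] [|[|//]] ? /=; rewrite ?expr1 ?expr0.
all: by rewrite !(mul0r, mulr0, mul1r, mulr1, addr0, add0r) // mulrNN mulr1.
Qed.

Definition negP1 : PGL2 F := \pi_(PGL2 F) (MkGL2 diagN1_unit).

Lemma negP1E P : PGL2_act negP1 P = omap -%R P.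
Proof.
rewrite PGL2_actE; case: P => [z|] /=; rewrite !mxE /= ?mul0r ?eqxx //.
by rewrite expr1 expr0 !(mul0r, mul1r, add0r, addr0) oner_eq0 divr1 mulN1r.
Qed.

Lemma negP1_neq1 : negP1 != 1%g.
Proof.
apply/eqP => E; have := negP1E (Some 1).
rewrite E PGL2_actE mobius1 => -[] /eqP.
by rewrite -subr_eq0 opprK (_ : 1 + 1 = 2%:R) // pnatr_eq0.
Qed.

Lemma negP1K : (negP1 * negP1)%g = 1%g.
Proof.
apply: PGL2_eq => /=; have [a ->] := PGL2_reprE (MkGL2 diagN1_unit).
by exists (a ^+ 2); rewrite /= -scalemxAl -scalemxAr scalerA diagN1K expr2.
Qed.

Lemma PGL2_diagP (g : PGL2 F) :
  [/\ repr g 0 1 = 0, repr g 1 0 = 0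
    & repr g 0 0 = repr g 1 1 \/ repr g 0 0 = - repr g 1 1] ->
  g = 1%g \/ g = negP1.
Proof.
case=> e0 c0 ad; rewrite -[g]reprK; case: ad => E; [left|right]; apply: PGL2_eq.
  exists (repr g 1 1); apply/matrixP => i j; rewrite !mxE.
  case: i j => -[|[|//]] i2 [] [|[|//]] j2 /=; rewrite ?mulr1 ?mulr0.
  - by rewrite -E; congr (repr g _ _); apply: val_inj.
  - by rewrite -e0; congr (repr g _ _); apply: val_inj.
  - by rewrite -c0; congr (repr g _ _); apply: val_inj.
  - by congr (repr g _ _); apply: val_inj.
exists (repr g 1 1); apply/matrixP => i j; rewrite !mxE.
case: i j => -[|[|//]] i2 [] [|[|//]] j2 /=; rewrite ?mul0r ?mul1r ?mulr1 ?mulr0 ?mulrN1.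
- by rewrite -E; congr (repr g _ _); apply: val_inj.
- by rewrite -e0; congr (repr g _ _); apply: val_inj.
- by rewrite -c0; congr (repr g _ _); apply: val_inj.
- by congr (repr g _ _); apply: val_inj.
Qed.

End NegPGL2.

Lemma isog_C2_pair (G : groupType) (A : G -> Prop) (s : G) :
  s != 1%g -> (s * s = 1)%g -> (forall g, A g <-> g = 1%g \/ g = s) -> isog_C2 A.
Proof.
move=> s1 ss AE; exists (fun x : 'Z_2 => if x == 0 then 1%g else s).
have Z2 (x : 'Z_2) : x = 0 \/ x = 1.
  by case: x => -[|[|//]] ?; [left | right]; apply: val_inj.
split.
- by move=> x y; have [->|->] := Z2 x; have [->|->] := Z2 y; rewrite /= ?mulg1 ?mul1g ?ss.
- move=> x y; have [->|->] := Z2 x; have [->|->] := Z2 y => //= E.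
    by rewrite E eqxx in s1.
  by rewrite E eqxx in s1.
move=> g; rewrite AE; split=> [[->|->]|[x <-]].
- by exists 0.
- by exists 1.
by case: ifP; [left|right].
Qed.

(** Conjugation invariance amounts to commuting with kz + b/z. [mobius_commutant] leaves only z and
    -z, and both commute because the map is odd. *)
Lemma Aut_phi_C2 (k b : rat) :
  k != 0 -> b != 0 -> 2 * k + 1 != 0 -> isog_C2 (Aut (phi_ k b)).
Proof.
move=> k0 b0 kN; apply: (isog_C2_pair (negP1_neq1 _) (negP1K _)) => g.
have K0 : ratr k != 0 :> algC by rewrite fmorph_eq0.
have B0 : ratr b != 0 :> algC by rewrite fmorph_eq0.
have KN : 2 * ratr k + 1 != 0 :> algC.
  have -> : 2 * ratr k + 1 = ratr (2 * k + 1) :> algC.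
    by rewrite rmorphD rmorphM rmorph1 rmorph_nat.
  by rewrite fmorph_eq0.
have AutE : Aut (phi_ k b) g <->
    forall P, kzbz (ratr k) (ratr b) (PGL2_act g P)
      = PGL2_act g (kzbz (ratr k) (ratr b) P).
  split=> comm P; have := comm P; rewrite !rat_map_algC_phi //.
    by move=> <-; rewrite PGL2_actVK.
  by move=> ->; rewrite PGL2_actK.
rewrite AutE; split=> [comm|[->|->] P].
- by apply: PGL2_diagP; apply: (mobius_commutant K0 B0 KN (GL2_unit _)).
- by rewrite !PGL2_actE !mobius1.
- by rewrite !negP1E kzbzN.
Qed.

(** * Fermat's right triangle theorem *)

Section Fermat.
Local Open Scope nat_scope.
Implicit Types a b c d A B U V : nat.

(** The root is g = gcd(a, c): with a = a'g and c = c'g one gets a'b = gc'^2, and by coprimality a'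
    and g divide each other. *)
Lemma coprime_sqr_factor a b c :
  coprime a b -> a * b = c ^ 2 -> exists d, a = d ^ 2.
Proof.
move=> cop E; have [->|a_gt0] := posnP a; first by exists 0.
set g := gcdn a c; have g_gt0 : 0 < g by rewrite gcdn_gt0 a_gt0.
have /dvdnP[a' aE] : g %| a by rewrite dvdn_gcdl.
have /dvdnP[c' cE] : g %| c by rewrite dvdn_gcdr.
have cop' : coprime a' c'.
  by rewrite /coprime -(eqn_pmul2r g_gt0) muln_gcdl -aE -cE mul1n.
have E' : a' * b = g * c' ^ 2.
  by apply/eqP; rewrite -(eqn_pmul2r g_gt0) mulnAC -aE E cE; apply/eqP; ring.
exists g; rewrite aE; suff -> : a' = g by [].
apply/eqP; rewrite eqn_dvd; apply/andP; split.
  by rewrite -(@Gauss_dvdl _ _ (c' ^ 2)) ?coprimeXr // -E' dvdn_mulr.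
rewrite -(@Gauss_dvdl _ _ b) ?E' ?dvdn_mulr //.
by apply: coprime_dvdl cop; rewrite aE dvdn_mull.
Qed.

Lemma sqr_mod4 a : a ^ 2 %% 4 = odd a.
Proof.
rewrite -{1}(odd_double_half a); set h := a./2.
rewrite (_ : _ ^ 2 = (odd a * h + h ^ 2) * 4 + odd a) ?modnMDl; last first.
  by rewrite -muln2; case: (odd a) => /=; nia.
by case: (odd a).
Qed.

Lemma coprime_sub_add a b :
  coprime a b -> odd (a + b) -> b <= a -> coprime (a - b) (a + b).
Proof.
move=> cop oddc le_ba; set d := gcdn (a - b) (a + b).
have dB : d %| a - b by apply: dvdn_gcdl.
have dD : d %| a + b by apply: dvdn_gcdr.
have d2 : coprime d 2 by rewrite coprimen2; apply: dvdn_odd dD oddc.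
have da : d %| a.
  rewrite -(Gauss_dvdr _ d2) (_ : 2 * a = (a - b) + (a + b)); last by lia.
  exact: dvdn_add.
have db : d %| b by rewrite -(dvdn_addr _ da).
by rewrite /coprime -dvdn1 -/d -(eqnP cop) dvdn_gcd da.
Qed.

(** The descent step. Coprimality gives p = e^2 and q = 2f^2; writing A = e^2 + 2g turns the first
    equation into (e^2 + g)g = f^4, so e^2 + g = S^4 and g = T^4. Then (S^2 - T^2)(S^2 + T^2) = e^2
    has coprime factors, which are squares. Since B = 2eST, T is smaller than B. *)
Lemma sum_diff_sqr_descent A B p q :
  coprime p q -> 0 < q -> ~~ odd q ->
  p ^ 2 + q ^ 2 = A ^ 2 -> 2 * p * q = B ^ 2 -> 0 < B ->
  exists S T U V, [/\ coprime S T, 0 < T < B,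
    S ^ 2 + T ^ 2 = U ^ 2 & S ^ 2 = T ^ 2 + V ^ 2].
Proof.
move=> cop q_gt0 evq EA EB B_gt0.
have oddp : odd p.
  have : coprime p 2 by apply: coprime_dvdr cop; rewrite dvdn2.
  by rewrite coprimen2.
have [q' qE] : exists q', q = 2 * q' by exists q./2; lia.
have [B' BE] : exists B', B = 2 * B'.
  exists B./2; suff : ~~ odd B by lia.
  by have := sqr_mod4 B; rewrite -EB qE; case: (odd B) => //; lia.
have EB' : p * q' = B' ^ 2 by move: EB; rewrite qE BE; nia.
have cop' : coprime p q' by apply: coprime_dvdr cop; rewrite qE dvdn_mull.
have [e pE] := coprime_sqr_factor cop' EB'.
have [f q'E] : exists f, q' = f ^ 2.
  by apply: (@coprime_sqr_factor q' p B'); rewrite 1?coprime_sym // mulnC.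
have odde : odd e by move: oddp; rewrite pE oddX.
have oddA : odd A.
  have : odd (A ^ 2) by rewrite -EA qE oddD !oddX oddp /= oddM.
  by rewrite oddX.
have le_eA : e ^ 2 <= A by rewrite -leq_sqr -EA pE; lia.
have [g AE] : exists g, A = e ^ 2 + 2 * g.
  by exists (A - e ^ 2)./2; have : odd (e ^ 2); [rewrite -pE | lia].
have Eg : (e ^ 2 + g) * g = (f ^ 2) ^ 2.
  by move: EA; rewrite AE pE qE q'E; nia.
have copg : coprime (e ^ 2 + g) g.
  rewrite /coprime gcdnC gcdnDr gcdnC -/(coprime _ _) -pE.
  apply: (@coprime_dvdr _ (q' ^ 2)); last by rewrite coprimeXr.
  by rewrite q'E -Eg dvdn_mull.
have [h hE] := coprime_sqr_factor copg Eg.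
have [l lE] : exists l, g = l ^ 2.
  by apply: (@coprime_sqr_factor g (e ^ 2 + g) (f ^ 2)); rewrite 1?coprime_sym // mulnC.
have hl : h * l = f ^ 2 by apply/eqP; rewrite -eqn_sqr expnMn -hE -lE Eg.
have cophl : coprime h l by rewrite -(@coprime_pexpl 2) // -(@coprime_pexpr 2) // -hE -lE.
have [S SE] := coprime_sqr_factor cophl hl.
have [T TE] : exists T, l = T ^ 2.
  by apply: (@coprime_sqr_factor l h f); rewrite 1?coprime_sym // mulnC.
have STf : S * T = f by apply/eqP; rewrite -eqn_sqr expnMn -SE -TE hl.
have copST : coprime S T.
  by rewrite -(@coprime_pexpl 2) // -(@coprime_pexpr 2) // -SE -TE.
have eST : (S ^ 2 - T ^ 2) * (S ^ 2 + T ^ 2) = e ^ 2.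
  by rewrite -subn_sqr -SE -TE -hE -lE addnK.
have e_gt0 : 0 < e by rewrite odd_gt0.
have f_gt0 : 0 < f by move: q_gt0; rewrite qE q'E; case: (f).
have leTS : T ^ 2 <= S ^ 2 by rewrite -SE -TE -leq_sqr -hE -lE leq_addl.
have cop2 : coprime (S ^ 2 - T ^ 2) (S ^ 2 + T ^ 2).
  apply: coprime_sub_add => //; first by rewrite coprimeXl ?coprimeXr.
  by apply: dvdn_odd (_ : odd (e ^ 2)); [rewrite -eST dvdn_mull | rewrite oddX].
have [V VE] := coprime_sqr_factor cop2 eST.
have [U UE] : exists U, S ^ 2 + T ^ 2 = U ^ 2.
  apply: (@coprime_sqr_factor _ (S ^ 2 - T ^ 2) e); first by rewrite coprime_sym.
  by rewrite mulnC.
exists S, T, U, V; split=> //; last by rewrite -VE addnC subnK.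
have B'E : B' = e * f.
  by apply/eqP; rewrite -eqn_sqr -EB' pE q'E expnMn.
have [S_gt0 T_gt0] : 0 < S /\ 0 < T by apply/andP; rewrite -muln_gt0 STf.
rewrite T_gt0 BE B'E -STf !mulnA -{1}(mul1n T) ltn_pmul2r //.
by have : 0 < e * S; rewrite ?muln_gt0 ?e_gt0 //; lia.
Qed.

(** Infinite descent on B. Modulo 4, A is odd and B is even, so U and V are odd and p = (U + V)/2, q
    = (U - V)/2 satisfy p^2 + q^2 = A^2 and 2pq = B^2. Exactly one of p, q is even, and it takes the
    role of q in [sum_diff_sqr_descent]. *)
Lemma no_sum_diff_sqr B A U V :
  coprime A B -> A ^ 2 + B ^ 2 = U ^ 2 -> A ^ 2 = B ^ 2 + V ^ 2 -> B = 0.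
Proof.
elim/ltn_ind: B A U V => B IH A U V cop EU EV.
have [//|B_gt0] := posnP B.
have oddAB : odd A /\ ~~ odd B.
  have := congr1 (modn^~ 4) EV; have := congr1 (modn^~ 4) EU.
  rewrite -(modnDm (A ^ 2)) -(modnDm (B ^ 2)) !sqr_mod4.
  have : odd A || odd B.
    apply/negPn; rewrite negb_or; apply/negP => /andP[eA eB].
    have : 2 %| gcdn A B by rewrite dvdn_gcd !dvdn2 eA.
    by rewrite (eqnP cop).
  by case: (odd A); case: (odd B); case: (odd U); case: (odd V).
have [oddA evB] := oddAB.
have oddU : odd U.
  by have := congr1 odd EU; rewrite oddD !oddX oddA (negPf evB) /= => <-.
have oddV : odd V.
  by have := congr1 odd EV; rewrite oddD !oddX oddA (negPf evB) /= => <-.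
have leVU : V <= U by rewrite -leq_sqr -EU EV -addnA addnCA leq_addr.
have [p [q [UE VE]]] : exists p q, U = p + q /\ V + q = p.
  by exists (U + V)./2, (U - V)./2; lia.
have EA : p ^ 2 + q ^ 2 = A ^ 2 by nia.
have EB : 2 * p * q = B ^ 2 by nia.
have copq : coprime p q.
  have dp := dvdn_gcdl p q; have dq := dvdn_gcdr p q.
  rewrite /coprime -dvdn1 -(eqnP cop) dvdn_gcd -(@dvdn_pexp2r _ A 2) //.
  rewrite -(@dvdn_pexp2r _ B 2) // -EA -EB dvdn_add ?dvdn_exp2r //=.
  by rewrite -mulnA dvdn_mull // -mulnn dvdn_mul.
have [p_gt0 q_gt0] : 0 < p /\ 0 < q.
  have : 0 < 2 * p * q by rewrite EB expn_gt0 B_gt0.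
  by rewrite !muln_gt0 => /andP[].
have oddpq : odd p (+) odd q.
  have := congr1 odd EA; rewrite oddD !oddX /= oddA; by case: (odd p); case: (odd q).
have [S [T [U' [V' [copST /andP[T_gt0 ltTB] EU' EV']]]]] :
    exists S T U V, [/\ coprime S T, 0 < T < B,
      S ^ 2 + T ^ 2 = U ^ 2 & S ^ 2 = T ^ 2 + V ^ 2].
  have [oddq|evq] := boolP (odd q); last exact: sum_diff_sqr_descent EA EB _.
  apply: (@sum_diff_sqr_descent A B q p) => //; first by rewrite coprime_sym.
  - by move: oddpq; rewrite oddq; case: (odd p).
  - by rewrite addnC.
  - by rewrite mulnAC.
by have T0 := IH T ltTB S U' V' copST EU' EV'; rewrite T0 in T_gt0.
Qed.

Lemma no_sum_diff_sqr_nat A B U V :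
  A ^ 2 + B ^ 2 = U ^ 2 -> A ^ 2 = B ^ 2 + V ^ 2 -> B = 0.
Proof.
have [//|B_gt0] := posnP B => EU EV; set g := gcdn A B.
have g_gt0 : 0 < g by rewrite gcdn_gt0 B_gt0 orbT.
have gA : g %| A := dvdn_gcdl A B; have gB : g %| B := dvdn_gcdr A B.
have gU : g %| U by rewrite -(@dvdn_pexp2r _ _ 2) // -EU dvdn_add ?dvdn_exp2r.
have gV : g %| V.
  rewrite -(@dvdn_pexp2r _ _ 2) // -(@dvdn_addr (B ^ 2)) -?EV ?dvdn_exp2r //.
have cop : coprime (A %/ g) (B %/ g).
  by rewrite /coprime -(eqn_pmul2r g_gt0) muln_gcdl !divnK // mul1n.
have g2_gt0 : 0 < g ^ 2 by rewrite expn_gt0 g_gt0.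
have /eqP : B %/ g = 0.
  apply: (no_sum_diff_sqr (U := U %/ g) (V := V %/ g) cop).
    apply/eqP; rewrite -(eqn_pmul2r g2_gt0) mulnDl -!expnMn !divnK //.
    by apply/eqP.
  apply/eqP; rewrite -(eqn_pmul2r g2_gt0) mulnDl -!expnMn !divnK //.
  by apply/eqP.
by rewrite -(eqn_pmul2r g_gt0) divnK // => /eqP.
Qed.

Lemma rat_no_sum_diff_sqr (X Y U V : rat) :
  (X ^+ 2 + Y ^+ 2 = U ^+ 2 -> X ^+ 2 - Y ^+ 2 = V ^+ 2 -> Y = 0)%R.
Proof.
move=> EU EV; pose D : int := (denq X * denq Y * denq U * denq V)%R.
have D0 : (D%:~R != 0 :> rat)%R by rewrite intr_eq0 !mulf_neq0 ?denq_neq0.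
have scaled (Z : rat) (d : int) : (D = denq Z * d)%R ->
    exists z : int, (Z * D%:~R = z%:~R)%R.
  by move=> ->; exists (numq Z * d)%R; rewrite !rmorphM /= numqE mulrA.
have [x xE] : exists z : int, (X * D%:~R = z%:~R)%R.
  by apply: (scaled _ (denq Y * denq U * denq V)%R); rewrite /D; ring.
have [y yE] : exists z : int, (Y * D%:~R = z%:~R)%R.
  by apply: (scaled _ (denq X * denq U * denq V)%R); rewrite /D; ring.
have [u uE] : exists z : int, (U * D%:~R = z%:~R)%R.
  by apply: (scaled _ (denq X * denq Y * denq V)%R); rewrite /D; ring.
have [v vE] : exists z : int, (V * D%:~R = z%:~R)%R.
  by apply: (scaled _ (denq X * denq Y * denq U)%R); rewrite /D; ring.
have sqrE (z : int) : Posz (`|z| ^ 2)%N = (z ^+ 2)%R.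
  by rewrite -abszX gez0_abs // sqr_ge0.
have Eu : (`|x| ^ 2 + `|y| ^ 2 = `|u| ^ 2)%N.
  apply/eqP; rewrite -eqz_nat PoszD !sqrE -(eqr_int rat) rmorphD !rmorphXn /=.
  by rewrite -xE -yE -uE !exprMn -mulrDl EU.
have Ev : (`|x| ^ 2 = `|y| ^ 2 + `|v| ^ 2)%N.
  apply/eqP; rewrite -eqz_nat PoszD !sqrE -(eqr_int rat) rmorphD !rmorphXn /=.
  by rewrite -xE -yE -vE !exprMn -mulrDl -EV subrKC.
have /eqP := no_sum_diff_sqr_nat Eu Ev.
by rewrite absz_eq0 -(intr_eq0 rat) -yE mulf_eq0 (negPf D0) orbF => /eqP.
Qed.
End Fermat.

(** * Periodic points of kz + b/z *)

Section PeriodicPoints.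
Variables (T : Type) (f : T -> T).

Lemma not_periodic_increasing (A : T -> Prop) (mu : T -> rat) (x : T) :
  (forall t, A t -> A (f t) /\ mu t < mu (f t)) -> A x -> ~ periodic f x.
Proof.
move=> incr Ax [] [|n] [] // _ E.
suff: forall m, A (iter m.+1 f x) /\ mu x < mu (iter m.+1 f x).
  by move/(_ n)=> [_]; rewrite E ltxx.
elim=> [|m [Am lt_m]]; first exact: incr.
by have [A' lt'] := incr _ Am; split=> //; apply: lt_trans lt'.
Qed.

Lemma periodic_image (x : T) : periodic f x -> periodic f (f x).
Proof. by case=> n [n0 E]; exists n; rewrite -iterSr iterS E. Qed.

Lemma periodic_preperiod1 (x : T) : periodic f x -> f (f x) = f x -> f x = x.
Proof.
move=> [] [|n] [] // _ E ff; rewrite -[RHS]E.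
by elim: n {E} => //= n <-; rewrite ff.
Qed.

End PeriodicPoints.

Lemma periodic_exact (T : eqType) (f : T -> T) (x : T) :
  periodic f x -> exists n, exact_period f n x.
Proof.
case=> n [n0 /eqP E].
have ex : exists n, (0 < n)%N && (iter n f x == x) by exists n; rewrite n0.
case: (ex_minnP ex) => m /andP[m0 /eqP Em] min; exists m; split=> // l /andP[l0 ltlm] El.
by move: ltlm; rewrite ltnNge min // l0 El eqxx.
Qed.

(** The Chebyshev map, which sends u + 1/u to u^2 + 1/u^2. *)
Definition sqr_sub2 (t : rat) : rat := t ^+ 2 - 2.

(** The map squares denominators, so a periodic t is an integer; beyond absolute value 2 the orbit
    grows. Among the integers from -2 to 2, the points -2, 0 and 1 fall onto the fixed points 2 and
    -1 without returning. *)
Lemma periodic_sqr_sub2 (t : rat) : periodic sqr_sub2 t -> t = 2 \/ t = -1.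
Proof.
move=> per; pose g := sqr_sub2.
have denE u : denq (g u) = denq u ^+ 2.
  have d0 : (denq u)%:~R != 0 :> rat by rewrite intr_eq0 denq_neq0.
  have -> : g u = (numq u ^+ 2 - denq u ^+ 2 * 2)%:~R / (denq u ^+ 2)%:~R.
    by rewrite rmorphB rmorphM !rmorphXn /= numqE /g /sqr_sub2; field; exact: d0.
  have cop : coprimez (numq u ^+ 2 - denq u ^+ 2 * 2) (denq u ^+ 2).
    have : coprimez (numq u ^+ 2) (denq u ^+ 2).
      by rewrite coprimezXl // coprimezXr // coprimezE coprime_num_den.
    rewrite !(coprimez_sym _ (denq u ^+ 2)) /coprimez -(gcdzMDl (- 2)).
    by rewrite addrC mulNr (mulrC 2).
  by rewrite coprimeq_den // sqrf_eq0 (negPf (denq_neq0 _)) ger0_norm // sqr_ge0.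
have den1 : denq t = 1.
  apply/eqP/negPn/negP => den_neq1; have := per.
  apply: (@not_periodic_increasing _ _ (fun u => 1 < denq u) (fun u => (denq u)%:~R)).
    move=> u gt1; rewrite denE ltr_int; split; nia.
  by have := denq_gt0 t; move: den_neq1; lia.
have le2 : `|t| <= 2.
  rewrite leNgt; apply/negP => gt2; have := per.
  apply: (@not_periodic_increasing _ _ (fun u => 2 < `|u|) (fun u => `|u|)) => // u gt.
  have lt : `|u| < `|g u|.
    rewrite /g /sqr_sub2; apply: (@lt_le_trans _ _ (`|u| ^+ 2 - 2)); first by nra.
    by rewrite real_normK ?num_real // ler_norm.
  by split=> //; apply: lt_trans lt.
have tE : t = (numq t)%:~R by rewrite numqE den1 mulr1.
move: per le2; rewrite tE; move: (numq t) => {tE den1} {}t per.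
rewrite -intr_norm -[2]/(2%:~R) ler_int => le2.
have cases : t = -2 \/ t = -1 \/ t = 0 \/ t = 1 \/ t = 2 by lia.
case: cases per => [|[|[|[|]]]] -> per; [left|by right|left|right|by left].
- by have /eqP := periodic_preperiod1 per (erefl _).
- by have /eqP := periodic_preperiod1 (periodic_image per) (erefl _).
- by have /eqP := periodic_preperiod1 per (erefl _).
Qed.

Section Orbits.
Variables (F : fieldType) (k b : F).
Local Notation phi := (kzbz k b).

Lemma iter_kzbz_None n : iter n phi None = None.
Proof. by elim: n => //= n ->. Qed.

(** Infinity is absorbing and 0 is sent to it, so the orbit of a finite periodic point avoids
    both. *)
Lemma periodic_kzbz_finite x n :
  periodic phi (Some x) -> exists2 z, z != 0 & iter n phi (Some x) = Some z.
Proof.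
move=> [p [p0 E]].
have EM m : iter (m * p) phi (Some x) = Some x.
  by elim: m => // m IH; rewrite mulSn iterD IH E.
have : iter n.+1 phi (Some x) <> None.
  move=> N; have := EM n.+1; have le : (n.+1 <= n.+1 * p)%N by rewrite leq_pmulr.
  by rewrite -(subnK le) iterD N iter_kzbz_None.
rewrite iterS; case: (iter n phi _) => //= z.
by case: (eqVneq z 0) => // z0 _; exists z.
Qed.

Lemma kzbz_eqP x y : x != 0 -> phi (Some x) = Some y <-> k * x ^+ 2 + b = x * y.
Proof.
move=> x0; rewrite kzbz_some //; split=> [[<-]|E]; first by field.
congr Some; apply: (mulfI x0); rewrite -E; field; exact: x0.
Qed.

End Orbits.

(* Here k = -1/2 and kz + b/z is conjugate to u -> u^-2 by u = (z+w)/(z-w),    *)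
(* w^2 = -2b; t = u + 1/u is defined over Q and conjugates u^-2 to t^2 - 2.    *)
Lemma periodic_kzbz_half (b x : rat) :
  b != 0 -> periodic (kzbz (- (1 / 2)) b) (Some x) ->
  iter 2 (kzbz (- (1 / 2)) b) (Some x) = Some x.
Proof.
move=> b0 per; set phi := kzbz _ b.
have x0 : x != 0 by have [z z0 [->]] := periodic_kzbz_finite 0 per.
change (phi (phi (Some x)) = Some x).
(* At the poles of [tau], phi swaps x and -x. *)
have [E|ne] := eqVneq (x ^+ 2 + 2 * b) 0.
  have phix : phi (Some x) = Some (- x) by apply/kzbz_eqP => //; lra.
  rewrite phix; apply/kzbz_eqP; rewrite ?oppr_eq0 //; lra.
pose tau (z : rat) : rat := 2 * (z ^+ 2 - 2 * b) / (z ^+ 2 + 2 * b).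
pose g := sqr_sub2.
have orbit n : exists z : rat, [/\ z != 0, z ^+ 2 + 2 * b != 0,
    iter n phi (Some x) = Some z & tau z = iter n g (tau x)].
  elim: n => [|n [z [z0 zb zE tE]]]; first by exists x.
  have [y y0 yE] := periodic_kzbz_finite n.+1 per.
  move: yE; rewrite iterS -/phi zE => /[dup] yE /(kzbz_eqP _ _ _ z0) zy.
  have yzE : y = (2 * b - z ^+ 2) / (2 * z).
    by apply: (mulfI z0); rewrite -zy; field.
  have ybE : y ^+ 2 + 2 * b = (z ^+ 2 + 2 * b) ^+ 2 / (4 * z ^+ 2).
    by rewrite yzE; field.
  have yb : y ^+ 2 + 2 * b != 0.
    by rewrite ybE mulf_neq0 ?expf_neq0 // invr_eq0 mulf_neq0 ?expf_neq0.
  exists y; split=> //; rewrite iterS -tE /tau /g /sqr_sub2 ybE yzE; field.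
  by rewrite z0 zb.
have : periodic g (tau x).
  case: per => n [n0 En]; exists n; split=> //.
  by have [z [_ _ zE <-]] := orbit n; move: zE; rewrite En => -[->].
(* The value 2 is impossible, since 2 - tau(x) = 8b/(x^2 + 2b); the value -1 means 3x^2 = 2b, so x
   is fixed. *)
move=> /periodic_sqr_sub2[] tx.
  have : 8 * b = (2 - tau x) * (x ^+ 2 + 2 * b) by rewrite /tau; field.
  by rewrite tx subrr mul0r => /eqP; rewrite mulf_eq0 (negPf b0).
have xb : 3 * x ^+ 2 - 2 * b = (tau x + 1) * (x ^+ 2 + 2 * b) by rewrite /tau; field.
rewrite tx addNr mul0r in xb.
have phix : phi (Some x) = Some x by apply/kzbz_eqP => //; lra.
by rewrite !phix.
Qed.

Section ShortCycles.
Variables (T : Type) (f : T -> T) (x0 x1 x2 x3 : T).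

Lemma exact_period1 : f x0 = x0 -> exact_period f 1 x0.
Proof. by split=> // -[|m] /andP[]. Qed.

Lemma exact_period2 : f x0 = x1 -> f x1 = x0 -> x1 <> x0 -> exact_period f 2 x0.
Proof.
move=> f0 f1 ne; split=> //; first by rewrite /= f0 f1.
by move=> [|[|m]] //= _; rewrite f0.
Qed.

Lemma exact_period3 : f x0 = x1 -> f x1 = x2 -> f x2 = x0 ->
  x1 <> x0 -> x2 <> x0 -> exact_period f 3 x0.
Proof.
move=> f0 f1 f2 ne1 ne2; split=> //; first by rewrite /= f0 f1 f2.
by move=> [|[|[|m]]] //= _; rewrite f0 ?f1.
Qed.

Lemma exact_period4 : f x0 = x1 -> f x1 = x2 -> f x2 = x3 -> f x3 = x0 ->
  x1 <> x0 -> x2 <> x0 -> x3 <> x0 -> exact_period f 4 x0.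
Proof.
move=> f0 f1 f2 f3 ne1 ne2 ne3; split=> //; first by rewrite /= f0 f1 f2 f3.
by move=> [|[|[|[|m]]]] //= _; rewrite f0 ?f1 ?f2.
Qed.

Lemma exact_period_periodic n x : exact_period f n x -> periodic f x.
Proof. by case=> n0 E _; exists n. Qed.

End ShortCycles.

Lemma manes_kzbz (k b x : rat) N :
  manes_conjecture -> k != 0 -> b != 0 ->
  exact_period (kzbz k b) N (Some x) -> (N <= 4)%N.
Proof.
move=> manes k0 b0 per; rewrite leqNgt; apply/negP => gt4.
have [kN|kN] := eqVneq (2 * k + 1) 0; last first.
  apply: (manes _ (rat_degree_phi k0 b0) (Aut_phi_C2 k0 b0 kN) _ gt4).
  exists x; case: per => N0 E min; split=> //.
    by rewrite (eq_iter (rat_map_phi k0 b0)).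
  by move=> m lt_m; rewrite (eq_iter (rat_map_phi k0 b0)); apply: min.
have kE : k = - (1 / 2) by lra.
have [_ _ /(_ 2)] := per; rewrite (ltn_trans _ gt4) // => /(_ isT); apply.
by rewrite kE; apply: periodic_kzbz_half => //; rewrite -kE;
  apply: exact_period_periodic per.
Qed.

(** * Rational cycles of kz + b/z of length 1 to 4 *)

Section RationalCycles.
Variables k b : rat.
Hypotheses (k0 : k != 0) (b0 : b != 0).
Local Notation phi := (kzbz k b).
Implicit Types x y z w q : rat.

Lemma periodic_kzbz_step x : periodic phi (Some x) ->
  x != 0 /\ exists y, phi (Some x) = Some y /\ periodic phi (Some y).
Proof.
move=> per; have [z z0 [zE]] := periodic_kzbz_finite 0 per.
rewrite -zE in z0; split=> //.
have [y _ /= E] := periodic_kzbz_finite 1 per.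
by exists y; split=> //; have := periodic_image per; rewrite [phi _]E.
Qed.

(** The parameter is q = (k - 1)x; its excluded values 0 and -x correspond to b = 0 and k = 0. *)
Lemma kzbz_exact1 x : exact_period phi 1 (Some x) ->
  exists q, [/\ q \notin [:: 0; - x], k = (q + x) / x & b = - (q * x)].
Proof.
move=> per; have [x0 _] := periodic_kzbz_step (exact_period_periodic per).
case: per => _ /(kzbz_eqP _ _ _ x0) E _.
have bE : b = - ((k - 1) * x * x) by lra.
exists ((k - 1) * x); split=> //; last by field.
rewrite !inE negb_or; apply/andP; split; apply: contraNneq b0 => q0.
  by rewrite bE q0 mul0r oppr0.
have : k * x == 0 by apply/eqP; lra.
by rewrite mulf_eq0 (negPf k0) (negPf x0).
Qed.

(** Both cycle equations have right-hand side xy, so k(x^2 - y^2) = 0 and y = -x; the parameter is q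
    = (k + 1)x. *)
Lemma kzbz_exact2 x : exact_period phi 2 (Some x) ->
  exists q, [/\ q \notin [:: 0; x], k = (q - x) / x & b = - (q * x)].
Proof.
move=> per; have [x0 [y [xy pery]]] := periodic_kzbz_step (exact_period_periodic per).
have [y0 _] := periodic_kzbz_step pery.
have yx : phi (Some y) = Some x by case: per; rewrite /iter xy.
have nxy : x != y.
  by case: per => _ _ /(_ 1%N isT); rewrite /iter xy => ne;
    apply: contra_notN ne => /eqP->.
move/(kzbz_eqP _ _ _ x0): xy => xy; move/(kzbz_eqP _ _ _ y0): yx => yx.
have yE : y = - x.
  have : (x - y) * (k * (x + y)) == 0 by apply/eqP; lra.
  rewrite !mulf_eq0 subr_eq0 (negPf nxy) (negPf k0) /=; lra.
subst y.
have bE : b = - ((k + 1) * x * x) by lra.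
exists ((k + 1) * x); split=> //; last by field.
rewrite !inE negb_or; apply/andP; split; apply: contraNneq b0 => q0.
  by rewrite bE q0 mul0r oppr0.
have : k * x == 0 by apply/eqP; lra.
by rewrite mulf_eq0 (negPf k0) (negPf x0).
Qed.

(* A 3-cycle of the odd map phi gives the 6-cycle x, -y, w, -x, y, -w of -phi. *)
Lemma kzbz_no_exact3 x : manes_conjecture -> ~ exact_period phi 3 (Some x).
Proof.
move=> manes per;
  have [x0 [y [xy pery]]] := periodic_kzbz_step (exact_period_periodic per).
have [y0 [w [yw perw]]] := periodic_kzbz_step pery.
have [w0 _] := periodic_kzbz_step perw.
have wx : phi (Some w) = Some x by case: per; rewrite /iter xy yw.
have nyx : y <> x.
  by case: per => _ _ /(_ 1%N isT); rewrite /iter xy => ne E; apply: ne; rewrite E.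
have nwx : w <> x.
  by case: per => _ _ /(_ 2%N isT); rewrite /iter xy yw => ne E; apply: ne; rewrite E.
set psi := kzbz (- k) (- b).
have psiE z z' : phi (Some z) = Some z' -> psi (Some z) = Some (- z').
  rewrite /psi /=; case: eqVneq => // _ [<-]; congr Some; ring.
have psiN z z' : phi (Some z) = Some z' -> psi (Some (- z)) = Some z'.
  rewrite /psi /= oppr_eq0; case: eqVneq => // z0 [<-]; congr Some; field; exact: z0.
have phiN z z' : phi (Some z) = Some z' -> phi (Some (- z)) = Some (- z').
  by move=> E; rewrite -[Some (- z)]/(omap -%R (Some z)) kzbzN E.
(* If -y = x, oddness gives y = phi(x) = -w, hence w = x. *)
have nyNx : - y <> x.
  move=> E; have := phiN _ _ yw; rewrite E xy => -[yE].
  by apply: nwx; rewrite -E yE opprK.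
have nxNx : - x <> x by move/eqP: x0 => x0 E; apply: x0; lra.
have nwNx : - w <> x.
  move=> E; have := phiN _ _ wx; rewrite E xy => -[yE].
  by apply: nyNx; rewrite yE opprK.
have per6 : exact_period psi 6 (Some x).
  clearbody psi; split=> //.
    by rewrite /iter (psiE _ _ xy) (psiN _ _ yw) (psiE _ _ wx) (psiN _ _ xy)
      (psiE _ _ yw) (psiN _ _ wx).
  case=> [|[|[|[|[|[|m]]]]]] //= _; rewrite (psiE _ _ xy).
  - by case=> /nyNx.
  - by rewrite (psiN _ _ yw); case=> /nwx.
  - by rewrite (psiN _ _ yw) (psiE _ _ wx); case=> /nxNx.
  - by rewrite (psiN _ _ yw) (psiE _ _ wx) (psiN _ _ xy); case=> /nyx.
  - by rewrite (psiN _ _ yw) (psiE _ _ wx) (psiN _ _ xy) (psiE _ _ yw); case=> /nwNx.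
by have := manes_kzbz manes _ _ per6; rewrite !oppr_eq0 => /(_ k0 b0).
Qed.

(* With x = s + d, z = s - d, y = t + e, w = t - e, the cycle equations force  *)
(* s = t = 0 or st <> 0; in the latter case s^2 - t^2 and 2st would be numbers *)
(* whose squares have square sum and square difference.                        *)
Lemma cycle4_symmetric x y z w :
  x != z -> y != w ->
  k * x ^+ 2 + b = x * y -> k * y ^+ 2 + b = y * z ->
  k * z ^+ 2 + b = z * w -> k * w ^+ 2 + b = w * x -> z = - x.
Proof.
move=> nxz nyw xy yz zw wx.
pose s := (x + z) / 2; pose d := (x - z) / 2; pose t := (y + w) / 2;
  pose e := (y - w) / 2.
have xE : x = s + d by rewrite /s /d; field.
have zE : z = s - d by rewrite /s /d; field.
have yE : y = t + e by rewrite /t /e; field.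
have wE : w = t - e by rewrite /t /e; field.
have d0 : d != 0 by apply: contraNneq nxz => d0; rewrite xE zE d0 !(addr0, subr0).
have e0 : e != 0 by apply: contraNneq nyw => e0; rewrite yE wE e0 !(addr0, subr0).
move: xy yz zw wx; rewrite {}xE {}yE {}zE {}wE => xy yz zw wx.
clearbody s d t e.
have elim_k u v : k * (u - v) = 0 -> u = v.
  by move/eqP; rewrite mulf_eq0 (negPf k0) subr_eq0 => /eqP.
(* In the original variables, [R1] and [R2] come from w(xy - yz) + y(zw - wx) = 0 and x(yz - zw) +
   z(wx - xy) = 0: replacing each product by its quadratic expression cancels b and leaves a factor
   k. *)
have R1 : t * (s ^+ 2 + d ^+ 2 - t ^+ 2 + e ^+ 2) = 2 * s * d * e.
  apply: elim_k;
    apply: (etrans (_ : _ = ((t - e) * ((k * (s + d) ^+ 2 + b) - (k * (t + e) ^+ 2 + b))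
     + (t + e) * ((k * (s - d) ^+ 2 + b) - (k * (t - e) ^+ 2 + b))) / 2)); first by field.
  by rewrite xy yz zw wx; field.
have R2 : s * (t ^+ 2 + e ^+ 2 - s ^+ 2 + d ^+ 2) = - (2 * t * d * e).
  apply: elim_k;
    apply: (etrans (_ : _ = ((s + d) * ((k * (t + e) ^+ 2 + b) - (k * (s - d) ^+ 2 + b))
     + (s - d) * ((k * (t - e) ^+ 2 + b) - (k * (s + d) ^+ 2 + b))) / 2)); first by field.
  by rewrite xy yz zw wx; field.
have [s0|s0] := eqVneq s 0; first by rewrite s0 sub0r add0r.
have t0 : t != 0.
  apply: contraNneq s0 => t0; move: R1; rewrite t0 mul0r => /esym/eqP.
  by rewrite !mulf_eq0 (negPf d0) (negPf e0) !orbF pnatr_eq0.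
have S : s * t * (d ^+ 2 + e ^+ 2) = d * e * (s ^+ 2 - t ^+ 2).
  have -> : s * t * (d ^+ 2 + e ^+ 2) =
    (s * (t * (s ^+ 2 + d ^+ 2 - t ^+ 2 + e ^+ 2))
     + t * (s * (t ^+ 2 + e ^+ 2 - s ^+ 2 + d ^+ 2))) / 2 by field.
  by rewrite R1 R2; field.
(* By [S], d/e is a root of st X^2 - (s^2 - t^2)X + st, so the discriminant (s^2 - t^2)^2 - (2st)^2
   is the square of 2st(d/e) - (s^2 - t^2). *)
have : 2 * s * t = 0.
  apply: (@rat_no_sum_diff_sqr (s ^+ 2 - t ^+ 2) _ (s ^+ 2 + t ^+ 2)
            (2 * s * t * d / e - (s ^+ 2 - t ^+ 2))); first by ring.
  apply/eqP; rewrite -subr_eq0; apply/eqP.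
  apply: (etrans (_ : _ = - 4 * s * t / e ^+ 2 *
    (s * t * (d ^+ 2 + e ^+ 2) - d * e * (s ^+ 2 - t ^+ 2)))); first by field.
  by rewrite S subrr mulr0.
by move/eqP; rewrite !mulf_eq0 (negPf s0) (negPf t0).
Qed.

(** Once z = -x, subtracting the first two cycle equations gives k(x^2 - y^2) = 2xy, so k depends
    only on q = x/y. *)
Lemma kzbz_exact4 x : exact_period phi 4 (Some x) ->
  exists q, [/\ q \notin [:: 0; 1; -1], k = 2 * q / (q ^+ 2 - 1)
    & b = - (x ^+ 2 * (q ^+ 2 + 1) / (q * (q ^+ 2 - 1)))].
Proof.
move=> per; have [x0 [y [xy pery]]] := periodic_kzbz_step (exact_period_periodic per).
have [y0 [z [yz perz]]] := periodic_kzbz_step pery.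
have [z0 [w [zw perw]]] := periodic_kzbz_step perz.
have [w0 _] := periodic_kzbz_step perw.
have wx : phi (Some w) = Some x by case: per; rewrite /iter xy yz zw.
have nxz : x != z.
  by case: per => _ _ /(_ 2%N isT); rewrite /iter xy yz => ne;
    apply: contra_notN ne => /eqP->.
have nyw : y != w.
  apply: contraNneq nxz => yw; move: wx; rewrite -yw yz => -[->] //.
move/(kzbz_eqP _ _ _ x0): xy => xy; move/(kzbz_eqP _ _ _ y0): yz => yz.
move/(kzbz_eqP _ _ _ z0): zw => zw; move/(kzbz_eqP _ _ _ w0): wx => wx.
have zE := cycle4_symmetric nxz nyw xy yz zw wx; subst z.
have kE : k * (x ^+ 2 - y ^+ 2) = 2 * x * y by lra.
have xy2 : x ^+ 2 - y ^+ 2 != 0.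
  apply: contra_eq_neq kE => ->; rewrite mulr0 eq_sym !mulf_neq0 //.
have kE' : k = 2 * x * y / (x ^+ 2 - y ^+ 2) by rewrite -kE mulfK.
have q2 : (x / y) ^+ 2 - 1 = (x ^+ 2 - y ^+ 2) / y ^+ 2 by field.
have q20 : (x / y) ^+ 2 - 1 != 0 by rewrite q2 mulf_neq0 // invr_eq0 expf_neq0.
exists (x / y); split.
- rewrite !inE mulf_eq0 invr_eq0 (negPf x0) (negPf y0) /= negb_or.
  by apply/andP; split; apply: contraNneq q20 => ->; rewrite ?sqrrN expr1n subrr.
- by rewrite kE' q2; field; rewrite xy2 y0.
have -> : b = x * y - k * x ^+ 2 by rewrite -xy; ring.
by rewrite kE' q2; field; rewrite xy2 x0 y0.
Qed.

End RationalCycles.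

(** * Periodic points of quadratic polynomials, and the families *)

Section QuadraticCycles.
Implicit Types c x y w p t : rat.

Lemma quadE c x : (quad c).[x] = x ^+ 2 + c.
Proof. by rewrite /quad hornerD hornerXn hornerC. Qed.

Lemma size_quad c : size (quad c) = 3%N.
Proof.
by rewrite /quad size_polyDl size_polyXn // (leq_ltn_trans (size_polyC_leq1 _)).
Qed.

(** Each difference along the cycle is the previous one times the sum of two neighbours. With t = x
    + y, the three differences adding up to zero gives t(w + y) = -(1 + t); together with w - y =
    t(y - x) this is linear in x. *)
Lemma quad_cycle3 c x y w :
  x != y -> x ^+ 2 + c = y -> y ^+ 2 + c = w -> w ^+ 2 + c = x ->
  exists t, [/\ t \notin [:: -1; 0], x = p_ t & c = c_ t].
Proof.
move=> nxy xy yw wx; pose t := x + y.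
have d0 : y - x != 0 by rewrite subr_eq0 eq_sym.
have wy : w - y = t * (y - x) by rewrite /t; lra.
have yE : y = t - x by rewrite /t; ring.
clearbody t; have xw : (w + y) * (w - y) = x - w by lra.
have wd : t * (w + y) = - (1 + t).
  apply: (mulIf d0).
  apply: (etrans (_ : _ = (w + y) * (t * (y - x)))); first by ring.
  by rewrite -wy xw mulNr mulrDl mul1r -wy; ring.
have t0 : t != 0.
  by apply: contra_eq_neq wd => ->; rewrite mul0r addr0 eq_sym oppr_eq0 oner_eq0.
have t1 : t + 1 != 0.
  apply: contraNneq nxy => t1; apply/eqP.
  have wy0 : w + y = 0 by move: wd; rewrite (_ : t = -1); lra.
  have x_w : x = w by apply/eqP; rewrite -subr_eq0 -xw wy0 mul0r.
  by rewrite -xy {2}x_w wx.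
rewrite {}yE in xy wy wd.
have xE : x = p_ t.
  apply: (mulIf (mulf_neq0 (mulf_neq0 (_ : 2 != 0) t0) t1)) => //.
  rewrite /p_ divfK ?mulf_neq0 //.
  have : t * (w - (t - x)) = t * (t * (t - x - x)) by rewrite wy.
  by lra.
exists t; split=> //; first by rewrite !inE negb_or -addr_eq0 t1.
have -> : c = t - x - x ^+ 2 by lra.
by rewrite xE /c_ /p_; field; rewrite t0 t1.
Qed.

Lemma quad_periodic c x :
  poonen_conjecture -> periodic (horner (quad c)) x ->
  [\/ c = x - x ^+ 2, x != - (1 / 2) /\ c = - (x ^+ 2 + x + 1) |
      exists t, [/\ t \notin [:: -1; 0], x = p_ t & c = c_ t]].
Proof.
move=> poonen /periodic_exact[n per].
have : (n < 4)%N.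
  by rewrite ltnNge; apply/negP => le4; apply: (poonen n le4 _ (size_quad c)); exists x.
case: per; case: n => [|[|[|[|//]]]] // _; rewrite /iter !quadE => E min _.
- by constructor 1; lra.
- have ne : x ^+ 2 + c <> x by move=> E1; apply: (min 1%N) => //=; rewrite quadE.
  (* For y = f(x) and f(y) = x, subtraction gives (y - x)(y + x + 1) = 0. *)
  have E' : x ^+ 2 + c = - x - 1.
    have : (x ^+ 2 + c - x) * (x ^+ 2 + c - (- x - 1)) == 0 by apply/eqP; lra.
    by rewrite mulf_eq0 !subr_eq0 => /orP[/eqP|/eqP].
  constructor 2; split; last by lra.
  by apply: contra_notN ne => /eqP xE; rewrite E' xE; field.
- constructor 3; apply: (@quad_cycle3 c x (x ^+ 2 + c) ((x ^+ 2 + c) ^+ 2 + c)) => //.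
  by apply/eqP => E1; apply: (min 1%N) => //=; rewrite quadE.
Qed.

Lemma quad_points1 p x : x \in [:: p; 1 - p] ->
  exact_period (horner (quad (p - p ^+ 2))) 1 x.
Proof.
by rewrite !inE => /orP[] /eqP->; apply: exact_period1; rewrite quadE; ring.
Qed.

Lemma quad_points2 p x : p != - (1 / 2) -> x \in [:: p; - p - 1] ->
  exact_period (horner (quad (- (p ^+ 2 + p + 1)))) 2 x.
Proof.
move/eqP=> np; rewrite !inE => /orP[] /eqP->.
  by apply: (@exact_period2 _ _ _ (- p - 1)); rewrite ?quadE;
    [ring|ring|move=> ?; apply: np; lra].
by apply: (@exact_period2 _ _ _ p); rewrite ?quadE; [ring|ring|move=> ?; apply: np; lra].
Qed.

(** This is the common numerator of the differences between the points of the 3-cycle, so it makes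
    them distinct. *)
Lemma sqrD_add1_neq0 t : t ^+ 2 + t + 1 != 0.
Proof. by apply/eqP; nra. Qed.

Lemma quad_points3 t x : t \notin [:: -1; 0] -> x \in [:: p_ t; p'_ t; p''_ t] ->
  exact_period (horner (quad (c_ t))) 3 x.
Proof.
rewrite !inE negb_or => /andP[t1 t0].
have {}t1 : t + 1 != 0 by rewrite addr_eq0.
have tt := sqrD_add1_neq0 t.
have f1 : (quad (c_ t)).[p_ t] = p'_ t
  by rewrite quadE /c_ /p_ /p'_; field; rewrite t0 t1.
have f2 : (quad (c_ t)).[p'_ t] = p''_ t
  by rewrite quadE /c_ /p''_ /p'_; field; rewrite t0 t1.
have f3 : (quad (c_ t)).[p''_ t] = p_ t
  by rewrite quadE /c_ /p_ /p''_; field; rewrite t0 t1.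
have n1 : p_ t - p'_ t != 0.
  have -> : p_ t - p'_ t = (t ^+ 2 + t + 1) / (t * (t + 1))
    by rewrite /p_ /p'_; field; rewrite t0 t1.
  by rewrite !mulf_neq0 ?invr_eq0 ?mulf_neq0.
have n2 : p'_ t - p''_ t != 0.
  have -> : p'_ t - p''_ t = (t ^+ 2 + t + 1) / (t + 1)
    by rewrite /p''_ /p'_; field; rewrite t0 t1.
  by rewrite !mulf_neq0 ?invr_eq0 ?mulf_neq0.
have n3 : p_ t - p''_ t != 0.
  have -> : p_ t - p''_ t = (t ^+ 2 + t + 1) / t
    by rewrite /p_ /p''_; field; rewrite t0 t1.
  by rewrite !mulf_neq0 ?invr_eq0 ?mulf_neq0.
move: n1 n2 n3; rewrite !subr_eq0 => /eqP n1 /eqP n2 /eqP n3.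
move=> /or3P[] /eqP->.
- by apply: exact_period3 f1 f2 f3 _ _ => // /esym.
- by apply: exact_period3 f2 f3 f1 _ _ => // /esym.
- by apply: exact_period3 f3 f1 f2 _ _ => // /esym.
Qed.

(* Modulo 2 the homogenised cubic n^3 + 2 n^2 d + n d^2 + d^3 has no zero. *)
Lemma p_neq0 t : t \notin [:: -1; 0] -> p_ t != 0.
Proof.
rewrite !inE negb_or => /andP[t1 t0].
have {}t1 : t + 1 != 0 by rewrite addr_eq0.
rewrite /p_ mulf_neq0 ?invr_eq0 ?mulf_neq0 //; apply/eqP => E.
pose n := numq t; pose d := denq t.
have : n ^+ 3 + 2 * n ^+ 2 * d + n * d ^+ 2 + d ^+ 3 = 0.
  apply: (@intr_inj rat); have nE : n%:~R = t * d%:~R := numqE t.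
  apply: (etrans (_ : _ = d%:~R ^+ 3 * (t ^+ 3 + 2 * t ^+ 2 + t + 1))); first by ring: nE.
  by rewrite E mulr0.
have half (z : int) : exists h : int, z = 2 * h \/ z = 2 * h + 1.
  by exists (z %/ 2)%Z; lia.
have [n' nE] := half n; have [d' dE] := half d.
case: nE => nE; case: dE => dE; rewrite nE dE => eq0; try by lia.
have := coprime_num_den t; rewrite -/n -/d nE dE !abszM /coprime.
by rewrite -muln_gcdr; lia.
Qed.

End QuadraticCycles.

(** * Verification of the listed cycles of kz + b/z *)

Section PhiFamilies.
Implicit Types p q x : rat.

Lemma phi_points1 p q : p != 0 -> q \notin [:: 0; - p] ->
  [/\ (q + p) / p != 0, - (q * p) != 0 & forall x, x \in [:: p; - p] ->
    exact_period (kzbz ((q + p) / p) (- (q * p))) 1 (Some x)].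
Proof.
rewrite !inE negb_or => p0 /andP[q0 qp].
rewrite oppr_eq0 !mulf_neq0 ?invr_eq0 ?addr_eq0 //; split=> // x.
rewrite !inE => /orP[] /eqP->; apply: exact_period1; apply/kzbz_eqP;
  rewrite ?oppr_eq0 //; field; exact: p0.
Qed.

Lemma phi_points2 p q : p != 0 -> q \notin [:: 0; p] ->
  [/\ (q - p) / p != 0, - (q * p) != 0 & forall x, x \in [:: p; - p] ->
    exact_period (kzbz ((q - p) / p) (- (q * p))) 2 (Some x)].
Proof.
rewrite !inE negb_or => p0 /andP[q0 qp].
rewrite oppr_eq0 !mulf_neq0 ?invr_eq0 ?subr_eq0 //; split=> // x.
have npp : - p != p by apply: contraNneq p0; lra.
rewrite !inE => /orP[] /eqP->.
  apply: (@exact_period2 _ _ _ (Some (- p))).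
  + by apply/kzbz_eqP => //; field; exact: p0.
  + by apply/kzbz_eqP; rewrite ?oppr_eq0 //; field; exact: p0.
  + by case; apply/eqP.
apply: (@exact_period2 _ _ _ (Some p)).
+ by apply/kzbz_eqP; rewrite ?oppr_eq0 //; field; exact: p0.
+ by apply/kzbz_eqP => //; field; exact: p0.
+ by case=> /esym; apply/eqP.
Qed.

(** Only the first two images are computed; the others follow by oddness. Since q is neither 1 nor
    -1, p/q differs from p and from -p. *)
Lemma phi_points4 p q : p != 0 -> q \notin [:: 0; 1; -1] ->
  [/\ 2 * q / (q ^+ 2 - 1) != 0, - (p ^+ 2 * (q ^+ 2 + 1) / (q * (q ^+ 2 - 1))) != 0 &
    forall x, x \in [:: p; p / q; - p; - (p / q)] ->
    exact_period (kzbz (2 * q / (q ^+ 2 - 1))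
      (- (p ^+ 2 * (q ^+ 2 + 1) / (q * (q ^+ 2 - 1)))))
      4 (Some x)].
Proof.
rewrite !inE !negb_or => p0 /and3P[q0 q1 qN1].
have qq : q ^+ 2 - 1 != 0 by rewrite subr_eq0 sqrf_eq1 negb_or q1 qN1.
have q2 : q ^+ 2 + 1 != 0 by apply/eqP; nra.
set k := 2 * q / _; set b := - _.
have k0 : k != 0 by rewrite /k !mulf_neq0 ?invr_eq0.
have b0 : b != 0 by rewrite /b oppr_eq0 !mulf_neq0 ?invr_eq0 ?mulf_neq0 // expf_neq0.
split=> //; have pq0 : p / q != 0 by rewrite mulf_neq0 ?invr_eq0.
have f1 : kzbz k b (Some p) = Some (p / q).
  by apply/kzbz_eqP => //; rewrite /k /b; field; rewrite q0 qq.
have f2 : kzbz k b (Some (p / q)) = Some (- p).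
  by apply/kzbz_eqP => //; rewrite /k /b; field; rewrite q0 qq.
have f3 : kzbz k b (Some (- p)) = Some (- (p / q)).
  by rewrite -[Some (- p)]/(omap -%R (Some p)) kzbzN f1.
have f4 : kzbz k b (Some (- (p / q))) = Some p.
  by rewrite -[Some (- (p / q))]/(omap -%R (Some (p / q))) kzbzN f2 /= opprK.
have npq : p != p / q.
  by apply: contraNneq q1 => E; rewrite -[q == 1](inj_eq (mulfI pq0)) divfK // mulr1 -E.
have npNq : p != - (p / q).
  by apply: contraNneq qN1 => E;
    rewrite -[q == -1](inj_eq (mulfI pq0)) divfK // mulrN1 -E.
have nN (u : rat) : u != 0 -> u != - u by move=> u0; apply: contraNneq u0; lra.
have Sne (u v : rat) : u != v -> Some v <> Some u by move/eqP=> ne [/esym].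
have npp := nN _ p0; have npqpq := nN _ pq0.
have nNpq : p / q != - p by rewrite -eqr_opp opprK eq_sym.
have nNpNq : - p != - (p / q) by rewrite eqr_opp.
move=> x; rewrite !inE => /or4P[] /eqP->.
- by apply: exact_period4 f1 f2 f3 f4 _ _ _; apply: Sne.
- by apply: exact_period4 f2 f3 f4 f1 _ _ _; apply: Sne; rewrite // eq_sym.
- by apply: exact_period4 f3 f4 f1 f2 _ _ _; apply: Sne; rewrite // eq_sym.
- by apply: exact_period4 f4 f1 f2 f3 _ _ _; apply: Sne; rewrite // eq_sym.
Qed.

End PhiFamilies.

Lemma kzbz_periodic (k b x : rat) :
  manes_conjecture -> k != 0 -> b != 0 -> periodic (kzbz k b) (Some x) ->
  [\/ exists q, [/\ q \notin [:: 0; - x], k = (q + x) / x & b = - (q * x)],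
      exists q, [/\ q \notin [:: 0; x], k = (q - x) / x & b = - (q * x)] |
      exists q, [/\ q \notin [:: 0; 1; -1], k = 2 * q / (q ^+ 2 - 1)
        & b = - (x ^+ 2 * (q ^+ 2 + 1) / (q * (q ^+ 2 - 1)))]].
Proof.
move=> manes k0 b0 /periodic_exact[n per].
move: (per) (manes_kzbz manes k0 b0 per); case: n per => [|[|[|[|[|//]]]]] per //.
- by case: per.
- by constructor 1; apply: (kzbz_exact1 k0 b0 per).
- by constructor 2; apply: (kzbz_exact2 k0 b0 per).
- by case: (kzbz_no_exact3 k0 b0 manes per).
- by constructor 3; apply: (kzbz_exact4 k0 per).
Qed.

Lemma family_periodic i (m : member) : common_family i m ->
  [/\ mem_k m != 0, mem_b m != 0,
      forall x : rat, x \in phi_points m ->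
        exact_period (kzbz (mem_k m) (mem_b m)) (phi_period m) (Some x),
      forall x : rat, x \in f_points m ->
        exact_period (horner (quad (mem_c m))) (f_period m) x &
      (common_point m \in phi_points m) && (common_point m \in f_points m)].
Proof.
have part p : p \notin [:: 0; - (1 / 2)] -> p != 0 /\ p != - (1 / 2).
  by rewrite !inE negb_or => /andP[].
case=> [p q p0 qn|p q p0 qn|p q p0 qn
  |p q /part[p0 p2] qn|p q /part[p0 p2] qn|p q /part[p0 p2] qn|
  t q tn qn|t q tn qn|t q tn qn] /=; rewrite !mem_head.
- have [k0 b0 pts] := phi_points1 p0 qn; split;
  [exact: k0|exact: b0|exact: pts|exact: quad_points1|by []].
- have [k0 b0 pts] := phi_points2 p0 qn; split;
  [exact: k0|exact: b0|exact: pts|exact: quad_points1|by []].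
- have [k0 b0 pts] := phi_points4 p0 qn; split;
  [exact: k0|exact: b0|exact: pts|exact: quad_points1|by []].
- have [k0 b0 pts] := phi_points1 p0 qn; split;
  [exact: k0|exact: b0|exact: pts|by move=> x; apply: quad_points2|by []].
- have [k0 b0 pts] := phi_points2 p0 qn; split;
  [exact: k0|exact: b0|exact: pts|by move=> x; apply: quad_points2|by []].
- have [k0 b0 pts] := phi_points4 p0 qn; split;
  [exact: k0|exact: b0|exact: pts|by move=> x; apply: quad_points2|by []].
- have [k0 b0 pts] := phi_points1 (p_neq0 tn) qn; split;
  [exact: k0|exact: b0|exact: pts|by move=> x; apply: quad_points3|by []].
- have [k0 b0 pts] := phi_points2 (p_neq0 tn) qn; split;
  [exact: k0|exact: b0|exact: pts|by move=> x; apply: quad_points3|by []].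
- have [k0 b0 pts] := phi_points4 (p_neq0 tn) qn; split;
  [exact: k0|exact: b0|exact: pts|by move=> x; apply: quad_points3|by []].
Qed.

Theorem theorem3p7 :
  poonen_conjecture -> manes_conjecture ->
  (forall c k b : rat,
     [/\ k != 0, b != 0 &
         exists x : rat, periodic (horner (quad c)) x /\
                         periodic (rat_map (phi_ k b)) (Some x)] <->
     exists (i : nat) (m : member),
       common_family i m /\ [/\ c = mem_c m, k = mem_k m & b = mem_b m]) /\
  (forall (i : nat) (m : member), common_family i m ->
     [/\ forall x : rat, x \in phi_points m ->
           exact_period (rat_map (phi_ (mem_k m) (mem_b m))) (phi_period m) (Some x),
         forall x : rat, x \in f_points m ->
           exact_period (horner (quad (mem_c m))) (f_period m) x,
         common_point m \in phi_points m &
         common_point m \in f_points m]).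
Proof.
move=> poonen manes.
have exactE k b n P : k != 0 -> b != 0 ->
    exact_period (kzbz k b) n P -> exact_period (rat_map (phi_ k b)) n P.
  move=> k0 b0 [n0 E min]; split=> // [|m lt_m]; rewrite (eq_iter (rat_map_phi k0 b0)) //.
  exact: min.
split=> [c k b|i m fam]; last first.
  by have [k0 b0 phi_pts f_pts /andP[]] := family_periodic fam; split=> // x /phi_pts;
    apply: exactE.
split=> [[k0 b0 [x [perf perphi]]]|[i [m [fam [-> -> ->]]]]]; last first.
  have [k0 b0 phi_pts f_pts /andP[inphi inf]] := family_periodic fam.
  split=> //; exists (common_point m); split.
    exact: exact_period_periodic (f_pts _ inf).
  by apply: exact_period_periodic (exactE _ _ _ _ k0 b0 (phi_pts _ inphi)).
have per : periodic (kzbz k b) (Some x).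
  by case: perphi => n [n0 E]; exists n; rewrite -(eq_iter (rat_map_phi k0 b0)).
(* The point 0 is not periodic for phi, which supplies the condition that p is nonzero in families 1
   to 6. *)
have [x0 _] := periodic_kzbz_step per.
have [cE|[x2 cE]|[t [tn xE cE]]] := quad_periodic poonen perf;
have [[q [qn kE bE]]|[q [qn kE bE]]|[q [qn kE bE]]] := kzbz_periodic manes k0 b0 per;
  rewrite {k0 b0 perf perphi per}cE kE bE; try rewrite xE in qn *.
1: by exists 1%N; eexists; split; [exact: family1 x0 qn|].
1: by exists 2%N; eexists; split; [exact: family2 x0 qn|].
1: by exists 3%N; eexists; split; [exact: family3 x0 qn|].
1-3: have {}x2 : x \notin [:: 0; - (1 / 2)] by rewrite !inE negb_or x0.
1: by exists 4%N; eexists; split; [exact: family4 x2 qn|].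
1: by exists 5%N; eexists; split; [exact: family5 x2 qn|].
1: by exists 6%N; eexists; split; [exact: family6 x2 qn|].
1: by exists 7%N; eexists; split; [exact: family7 tn qn|].
1: by exists 8%N; eexists; split; [exact: family8 tn qn|].
by exists 9%N; eexists; split; [exact: family9 tn qn|].
Qed.
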